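(* Let $\lambda>0$, $r\ge0$ and $A>r$, and let $h=-\lambda\,\mathbf{1}_{[r,r+A]}$. Let $N^h$ be the Hawkes process with basal intensity $\lambda$, reproduction function $h$ and empty initial condition, and $N^h_t=N^h([0,t])$. Then $$\lim_{t\to\infty}\frac{N^h_t}{t}=\frac{\lambda(1+\lambda r)}{\lambda A+2\lambda r+e^{-\lambda r}}\qquad\text{almost surely.}$$
   Context: Hawkes process. Let $(\Omega,\mathcal{F},(\mathcal{F}_t)_{t\ge 0},\mathbb{P})$ be a filtered probability space satisfying the usual assumptions, carrying an $(\mathcal{F}_t)$-Poisson point process $Q$ on $(0,+\infty)\times(0,+\infty)$ with unit intensity (Lebesgue measure). The Hawkes process $N^h$ with basal intensity $\lambda>0$, reproduction function $h:(0,+\infty)\to\mathbb{R}$ and empty initial condition (no point on $(-\infty,0]$) is the point process on $(0,+\infty)$ solving $$N^h=\int_{(0,+\infty)\times(0,+\infty)}\delta_u\,\mathbf{1}_{\theta\le \Lambda^h(u)}\,Q(du,d\theta),\qquad \Lambda^h(u)=\Big(\lambda+\int_{(-\infty,u)}h(u-s)\,N^h(ds)\Big)^+,\quad u>0,$$ where $x^+=\max(x,0)$. Thus $\Lambda^h$ is the conditional intensity of $N^h$ with respect to $(\mathcal{F}_t)$. *)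

(* Defs.v *)
From HB Require Import structures.
From mathcomp Require Export all_boot all_order all_algebra.
From mathcomp Require Export all_classical all_reals all_analysis.
From mathcomp Require Export measurable_realfun.

Set Implicit Arguments.
Unset Strict Implicit.
Unset Printing Implicit Defensive.

Export Order.TTheory GRing.Theory Num.Theory.
Export numFieldNormedType.Exports.

Local Open Scope classical_set_scope.
Local Open Scope ring_scope.
Local Open Scope ereal_scope.

(* Filtrations are indexed by real times [t], only [0 <= t] being relevant. *)
Record usual_conditions (R : realType) (d : measure_display)
    (T : measurableType d) (P : probability T R) (F : R -> set (set T)) : Prop :=
  UsualConditions {
  filt_sigma_algebra : forall t : R, (0 <= t)%R -> sigma_algebra setT (F t) ;
  filt_measurable : forall t : R, (0 <= t)%R -> F t `<=` measurable ;
  filt_mono : forall s t : R, (0 <= s)%R -> (s <= t)%R -> F s `<=` F t ;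
  filt_right_continuous : forall t : R, (0 <= t)%R ->
    F t = \bigcap_(s in [set s : R | (t < s)%R]) F s ;
  filt_complete : forall A : set T, P.-negligible A -> F 0%R A }.

(* A point process on [E] is a random measure on the ambient space [S], carried
   by [E], with values in {0, 1, 2, ...} U {+oo} and finite on the compact
   subsets of [E]. The predicate [cpt] stands for compactness in [S], which is
   not part of the structure of a measurableType. *)
Record point_process (R : realType) (d : measure_display) (T : measurableType d)
    (d' : measure_display) (S : measurableType d') (cpt : set S -> Prop)
    (E : set S) (N : T -> {measure set S -> \bar R}) : Prop := PointProcess {
  pp_measurable : forall B : set S, measurable B ->
    measurable_fun setT (fun w : T => N w B) ;
  pp_integer : forall (w : T) (B : set S), measurable B ->
    N w B = +oo \/ exists k : nat, N w B = k%:R%:E ;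
  pp_support : forall w : T, N w (~` E) = 0 ;
  pp_locally_finite : forall (w : T) (K : set S), cpt K -> K `<=` E ->
    N w K < +oo }.

(* In [poisson_prob m 0%N U] the second argument of the library function is a
   dummy; for [m = 0] this is the Dirac mass at 0. *)
Record poisson_point_process (R : realType) (d : measure_display)
    (T : measurableType d) (P : probability T R)
    (d' : measure_display) (S : measurableType d') (cpt : set S -> Prop)
    (E : set S) (mu : set S -> \bar R)
    (Q : T -> {measure set S -> \bar R}) : Prop := PoissonPointProcess {
  ppp_point_process : point_process cpt E Q ;
  ppp_law : forall B : set S, measurable B -> B `<=` E -> mu B < +oo ->
    forall k : nat,
      P [set w | Q w B = k%:R%:E] = poisson_prob (fine (mu B)) 0%N [set k] ;
  ppp_law_infinite : forall B : set S, measurable B -> B `<=` E ->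
    mu B = +oo -> P [set w | Q w B = +oo] = 1 ;
  ppp_independent : forall (n : nat) (B : 'I_n -> set S)
      (C : 'I_n -> set (\bar R)),
    (forall i, measurable (B i)) -> (forall i, B i `<=` E) ->
    trivIset setT B -> (forall i, measurable (C i)) ->
    P (\bigcap_i [set w | C i (Q w (B i))]) =
    \prod_(i < n) P [set w | C i (Q w (B i))] }.

Definition events_in (R : realType) (d : measure_display) (T : measurableType d)
    (d' : measure_display) (S : measurableType d')
    (Q : T -> {measure set S -> \bar R}) (D : set S) : set (set T) :=
  <<s [set X | exists (B : set S) (C : set (\bar R)),
        [/\ measurable B, B `<=` D, measurable C & X = [set w | C (Q w B)]]] >>.

Definition positive (R : realType) : set R := [set u : R | (0 < u)%R].

(* (F_t)-Poisson point process on (0,+oo) x (0,+oo) with unit intensity, the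
   first coordinate being time: for every t the restriction of Q to
   (0,t] x (0,+oo) is F_t-measurable, its restriction to (t,+oo) x (0,+oo) is
   independent of F_t. *)
Record filtered_poisson (R : realType) (d : measure_display)
    (T : measurableType d) (P : probability T R) (F : R -> set (set T))
    (Q : T -> {measure set (R * R)%type -> \bar R}) : Prop :=
  FilteredPoisson {
  fp_poisson : poisson_point_process P (@compact (R * R)%type)
    (@positive R `*` @positive R)
    (@lebesgue_measure R \x @lebesgue_measure R) Q ;
  fp_adapted : forall t : R, (0 <= t)%R ->
    events_in Q (`]0%R, t] `*` @positive R) `<=` F t ;
  fp_independent : forall t : R, (0 <= t)%R ->
    forall X Y : set T, F t X ->
      events_in Q ([set u : R | (t < u)%R] `*` @positive R) Y ->
      P (X `&` Y) = P X * P Y }.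

Definition hawkes_intensity (R : realType) (lambda : R) (h : R -> R)
    (nu : {measure set R -> \bar R}) (u : R) : \bar R :=
  maxe (lambda%:E + \int[nu]_(s in [set s : R | (s < u)%R]) (h (u - s))%:E) 0.

(* The initial condition is empty: as a point process on (0,+oo), [N w] gives
   no mass to (-oo,0]. *)
Record hawkes_process (R : realType) (d : measure_display)
    (T : measurableType d) (P : probability T R)
    (Q : T -> {measure set (R * R)%type -> \bar R}) (lambda : R) (h : R -> R)
    (N : T -> {measure set R -> \bar R}) : Prop := HawkesProcess {
  hawkes_point_process : point_process (@compact R) (@positive R) N ;
  hawkes_equation : {ae P, forall w : T, forall B : set R, measurable B ->
    N w B =
    \int[Q w]_(x in @positive R `*` @positive R)
      (\d_(x.1) B *
       (\1_[set y : R * R | (y.2%:E <= hawkes_intensity lambda h (N w) y.1)%E]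
          x)%:E)} }.

(* Main.v *)
(** Since h takes the values 0 and -lambda, the intensity of N^h is lambda or 0,
   and N^h is a greedy thinning of the rate lambda Poisson process pi formed by
   the points of Q in the strip (0,+oo) x (0,lambda]: a point u of pi is kept if
   and only if no earlier kept point lies in [u - r - A, u - r]. The evolution is a
   succession of cycles: a waiting time; then, after the first kept point T, all
   the points of pi in (T, T + r) are kept; then nothing is kept up to
   S + r + A, where S is the last kept point, because r < A. The mean number of
   points of a cycle is 1 + lambda r, its mean duration
   1/lambda + (r - (1 - exp(-lambda r))/lambda) + r + A.

   The renewal argument, which would need the strong Markov property, is
   replaced by counting on a time grid. Let time be cut into cells of length
   delta, with r = L delta. The pair (cell occupied by pi, cell containing a
   kept point) satisfies purely combinatorial rules, except in the cells where an
   inhibition period ends, which affects a proportion O(delta) of the cycles.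
   Every count needed is a sum of products of an indicator known at the beginning of a
   window and of the indicator that pi charges this window, so that an L^2 law
   of large numbers for variables with finite range of dependence determines
   it. This gives almost sure bounds for N_t / t with an error vanishing with
   delta. *)
From HB Require Import structures.
Require Import Defs.
From mathcomp Require Import zify ring lra.

Set Implicit Arguments.
Unset Strict Implicit.
Unset Printing Implicit Defensive.

Local Open Scope classical_set_scope.
Local Open Scope ring_scope.

(** * Counting cycles in a discrete-time thinning *)

(** No random time is ever handled. A cell starts a cycle iff it is waiting and charged, and waiting
    is known before the cell; hence waiting cells are [1/p] times as numerous as starts, [p] being
    the probability that a cell is charged. Whether the cycle started in cell [i] still inhibits
    cell [i + m] is also one window event: pi must charge that part of the [L] cells following [i]
    which lies among the last [L + M + 1] cells before [i + m]. Summing the probabilities of these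
    events over [m] gives the mean duration without locating the last kept point.

    A bad cell can spoil O(1/delta) later cells, so bad cells must have density O(delta^2) per cell,
    not merely be rare among cycles.

    Cells are counted rather than points, which keeps all variables bounded by 1. Points sharing a
    cell are restored at the end: on each cell, N exceeds its occupation indicator by at most what
    pi exceeds its own, so an upper tail bound for pi is all that is required about
    multiplicities. *)

Section counting.
Local Open Scope nat_scope.

Lemma cover_count (c : nat -> bool) (att : nat -> nat -> bool) (K n : nat) :
  (forall k, k < n -> c k ->
     exists i m, [/\ m < K, k = i + m & att i m]) ->
  \sum_(k < n) c k <= \sum_(i < n) \sum_(m < K) att i m.
Proof.
move=> H.
have bnd (k : 'I_n) :
    c k <= \sum_(i < n) \sum_(m < K) (att i m && (k == i + m :> nat)).
  have [ck|//] := boolP (c k).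
  have [i [m [mK km aim]]] := H k (ltn_ord k) ck.
  have iN : i < n by move: (ltn_ord k); lia.
  rewrite (bigD1 (Ordinal iN)) //= (bigD1 (Ordinal mK)) //=.
  by rewrite aim -km eqxx.
apply: (leq_trans (leq_sum _ (fun k _ => bnd k))).
rewrite exchange_big /=; apply: leq_sum => i _.
rewrite exchange_big /=; apply: leq_sum => m _.
have [aim|] := boolP (att i m); last by rewrite big1.
have [lt|ge] := ltnP (i + m) n.
  rewrite (bigD1 (Ordinal lt)) //= eqxx big1 // => k /negP kne.
  by case: eqP => // e; exfalso; apply: kne; apply/eqP/val_inj.
rewrite big1 // => k _; case: eqP => // e.
by move: (ltn_ord k); lia.
Qed.

(** Attributions reaching the same cell share their source, hence their offset, so no cell is
    counted twice. The range grows to [n + K] because a source below [n] may reach past [n]. *)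
Lemma pack_count (c : nat -> bool) (att : nat -> nat -> bool) (K n : nat) :
  (forall i m, m < K -> att i m -> c (i + m)) ->
  (forall i m i' m', m < K -> m' < K -> att i m -> att i' m' ->
     i + m = i' + m' -> i = i') ->
  \sum_(i < n) \sum_(m < K) att i m <= \sum_(k < n + K) c k.
Proof.
move=> H1 H2.
have bnd (i : 'I_n) (m : 'I_K) :
    att i m <= \sum_(k < n + K) (att i m && (k == i + m :> nat)).
  have lt : i + m < n + K by move: (ltn_ord i) (ltn_ord m); lia.
  by rewrite (bigD1 (Ordinal lt)) //= eqxx andbT leq_addr.
apply: (@leq_trans (\sum_(i < n) \sum_(m < K) \sum_(k < n + K)
    (att i m && (k == i + m :> nat)))).
  by apply: leq_sum => i _; apply: leq_sum => m _; exact: bnd.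
under eq_bigr do rewrite exchange_big /=.
rewrite exchange_big /=; apply: leq_sum => k _.
have [/existsP[i0 /existsP[m0 /andP[a0 /eqP k0]]]|none] :=
  boolP [exists i : 'I_n, exists m : 'I_K, att i m && (k == i + m :> nat)].
  rewrite k0 H1 // (bigD1 i0) //= (bigD1 m0) //= a0 eqxx /=.
  rewrite big1 ?addn0; last first.
    move=> m /eqP mne; case: eqP => [e|_]; last by rewrite andbF.
    by exfalso; apply: mne; apply: val_inj => /=; lia.
  rewrite big1 // => i /eqP ine; rewrite big1 // => m _.
  have [/andP[a /eqP e]|//] := boolP (_ && _).
  exfalso; apply: ine; apply: val_inj => /=.
  by rewrite (H2 _ _ _ _ (ltn_ord m0) (ltn_ord m) a0 a e).
rewrite big1 // => i _; rewrite big1 // => m _.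
have [am|//] := boolP (_ && _).
by exfalso; move/negP: none; apply; apply/existsP; exists i;
  apply/existsP; exists m.
Qed.

End counting.

(* [xi k]: the cell [(k delta, (k+1) delta]] is charged by pi; [eta k]: it
   contains a kept point. The lag r is L cells and A is between M and M + 1
   cells, so that the position of points inside their cells leaves a gap of one
   cell between the ranges of [eta_block] and [eta_accept]. Inequalities are
   written without subtractions, which are truncated in [nat]. *)
Section discrete_dynamics.
Local Open Scope nat_scope.
Variables (L M : nat) (xi eta : nat -> bool).
Definition waiting (e : nat -> bool) k :=
  [forall j : 'I_k, (k <= j + L + M + 1) ==> ~~ e j].
Definition first k := waiting eta k && eta k.
(* The two cells where [eta_block] and [eta_accept] leave undecided whether the
   inhibition due to [j] is over. *)
Definition just_released k :=
  [exists j : 'I_k, ((k == j + L + M) || (k == j + L + M + 1)) && eta j].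
Definition bad k := just_released k && xi k.
Definition after_bad k := [exists b : 'I_k, (k <= b + L) && bad b].
Definition occupied a l := [exists j : 'I_l, xi (a + j)].

Lemma waitingP k :
  reflect (forall j, j < k -> k <= j + L + M + 1 -> ~~ eta j) (waiting eta k).
Proof.
apply: (iffP forallP) => [H j jk kj|H j].
  exact: (implyP (H (Ordinal jk))).
by apply/implyP; exact: H.
Qed.

Lemma occupiedP a l :
  reflect (exists2 j, a <= j < a + l & xi j) (occupied a l).
Proof.
apply: (iffP existsP) => [[j xj]|[j jal xj]].
  by exists (a + j) => //; move: (ltn_ord j); lia.
have jl : j - a < l by lia.
by exists (Ordinal jl) => /=; rewrite subnKC //; lia.
Qed.

Lemma after_badP k :
  reflect (exists2 b, b < k <= b + L & bad b) (after_bad k).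
Proof.
apply: (iffP existsP) => [[b /andP[kb bb]]|[b /andP[bk kb] bb]].
  by exists b => //; rewrite ltn_ord.
by exists (Ordinal bk) => /=; rewrite kb bb.
Qed.

Hypothesis LM : L < M.
Hypothesis eta_xi : forall k, eta k -> xi k.
Hypothesis eta_block : forall j k,
  j + L < k -> k < j + L + M -> eta j -> ~~ eta k.
Hypothesis eta_accept : forall k, xi k ->
  (forall j, j < k -> j + L <= k -> k <= j + L + M + 1 -> ~~ eta j) -> eta k.

Lemma just_releasedP k :
  reflect (exists2 j, k = j + L + M \/ k = j + L + M + 1 & eta j)
    (just_released k).
Proof.
apply: (iffP existsP) => [[j /andP[/orP[] /eqP kj ej]]|[j kj ej]].
- by exists j => //; left.
- by exists j => //; right.
have jk : j < k by lia.
by exists (Ordinal jk); rewrite ej andbT /=; case: kj => ->; rewrite eqxx ?orbT.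
Qed.

(** Waiting excludes every cell that could block [k], so acceptance depends on [xi k] alone. This
    turns the start of a cycle into a coin toss independent of the past. *)
Lemma firstE k : first k = waiting eta k && xi k.
Proof.
rewrite /first; case: waitingP => //= H.
by apply/idP/idP => [/eta_xi//|xk]; apply: eta_accept => // j ? ? ?; apply: H.
Qed.

Lemma first_gap i i' : first i -> first i' -> i < i' -> i + L + M + 1 < i'.
Proof.
move=> /andP[_ ei] /andP[/waitingP w _] ii'.
by rewrite ltnNge; apply/negP => le; move: (w i ii' le); rewrite ei.
Qed.

(** A cell [j] able to block [k] has [j + L <= k < i + L], hence lies before [i], and waiting at [i]
    already excludes it. *)
Lemma first_active i k : first i -> i < k -> k < i + L -> xi k -> eta k.
Proof.
move=> /andP[/waitingP w _] ik ki xk; apply: eta_accept => // j jk jl kj.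
by apply: w; lia.
Qed.

(** The source is the earliest kept cell [k0] among the [L] cells before [k] and [k] itself. If an
    older kept cell still matters at [k0], block rules leave only the two undecided positions, and
    then [k0] is bad. *)
Lemma eta_source k : eta k ->
  (exists2 i, first i & i <= k <= i + L) \/ (exists2 b, bad b & b <= k <= b + L).
Proof.
move=> ek.
pose P j := [&& k <= j + L, j <= k & eta j].
have exP : exists j, P j by exists k; rewrite /P ek leqnn leq_addr.
case: (ex_minnP exP) => k0 /and3P[kk0 k0k e0] k0min.
have [jr|njr] := boolP (just_released k0).
  by right; exists k0; [rewrite /bad jr eta_xi | rewrite k0k].
left; exists k0; last by rewrite k0k.
rewrite /first e0 andbT; apply/waitingP => j jk0 k0j; apply/negP => ej.
have [kj|jk] := leqP k (j + L).
  have : P j by rewrite /P kj ej (leq_trans (ltnW jk0) k0k).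
  by move/k0min; lia.
have [kjM|jMk] := ltnP k0 (j + L + M).
  have [k0jL|k0jL] := leqP k0 (j + L).
    (* [k] is within [2 * L] of [j], so [L < M], the discrete form of [r < A], puts [k] inside the
       inhibition due to [j]. *)
    have kjM' : k < j + L + M by lia.
    by move: (eta_block jk kjM' ej); rewrite ek.
  by move: (eta_block k0jL kjM ej); rewrite e0.
by move/negP: njr; apply; apply/just_releasedP; exists j => //; lia.
Qed.

(* [_ i m] attributes to the cycle started in the cell [i] the cell [i + m]:
   as containing a kept point for [eta_lo] and [eta_hi], as not waiting for
   [busy_lo] and [busy_hi]. The [_lo] attributions are sound and disjoint; the
   [_hi] ones miss only cells following a bad one. *)
Definition eta_lo i m := first i && ((m == 0) || ((m < L) && xi (i + m))).
Definition eta_hi i m := first i && ((m == 0) || xi (i + m)).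
Definition busy_lo i m := first i && ((0 < m) &&
  ((m <= L + M + 1) || occupied (i + (m - (L + M + 1))) (2 * L + M + 1 - m))).
Definition busy_hi i m := first i && ((0 < m) &&
  ((m <= L + M + 1) || occupied (i + (m - (L + M + 1))) (2 * L + M + 2 - m))).

Lemma eta_count_ge n :
  \sum_(i < n) \sum_(m < L.+1) eta_lo i m <= \sum_(k < n + L.+1) eta k.
Proof.
apply: (pack_count (att := eta_lo)) => [i m _ /andP[fi /orP[/eqP->|/andP[mL xm]]]|].
- by rewrite addn0; case/andP: fi.
- have [->|m0] := eqVneq m 0; first by rewrite addn0; case/andP: fi.
  by apply: (first_active fi) => //; lia.
move=> i m i' m' mL mL' /andP[fi _] /andP[fi' _] e.
by case: (ltngtP i i') => // [/(first_gap fi fi')|/(first_gap fi' fi)]; lia.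
Qed.

Lemma eta_count_le n :
  \sum_(k < n) eta k <= \sum_(i < n) \sum_(m < L.+1) eta_hi i m
     + \sum_(k < n) bad k + \sum_(k < n) (after_bad k && xi k).
Proof.
apply: (@leq_trans (\sum_(k < n) ((eta k && ~~ bad k && ~~ after_bad k)
   + bad k + (after_bad k && xi k)))).
  apply: leq_sum => k _; have [ek|//] := boolP (eta k).
  by rewrite eta_xi // andbT; case: (bad k); case: (after_bad k).
rewrite !big_split /= !leq_add2r.
apply: (cover_count (att := eta_hi)
  (c := fun k => eta k && ~~ bad k && ~~ after_bad k)).
move=> k kn /andP[/andP[ek nb] nab].
case: (eta_source ek) => [[i fi ik]|[b bb bk]]; last first.
  exfalso; have [e|ne] := eqVneq b k; first by move: nb; rewrite -e bb.
  by move/negP: nab; apply; apply/after_badP; exists b => //; lia.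
exists i, (k - i); split; [lia|lia|].
by rewrite /eta_hi fi /= subnKC ?(eta_xi ek) ?orbT //; lia.
Qed.

(** The occupied window runs from [i + m - (L + M + 1)] to [i + L] excluded: a charged cell there is
    kept by [first_active] and still inhibits [i + m]. Two cycles cannot claim the same cell, since
    the kept cell responsible in the earlier one would contradict waiting at the start of the later
    one. *)
Lemma busy_count_ge n :
  \sum_(i < n) \sum_(m < 2 * L + M + 1) busy_lo i m <=
  \sum_(k < n + (2 * L + M + 1)) ~~ waiting eta k.
Proof.
have src i m : m < 2 * L + M + 1 -> busy_lo i m ->
    exists2 j, eta j & [/\ i <= j, j < i + m, i + m <= j + L + M + 1
                         & j = i \/ j < i + L].
  move=> mK /andP[fi /andP[m0 /orP[mle|/occupiedP[j jj xj]]]].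
    by exists i; [by case/andP: fi|split; lia].
  have [mle|mgt] := leqP m (L + M + 1).
    by exists i; [by case/andP: fi|split; lia].
  exists j; last by split; lia.
  by apply: (first_active fi) => //; lia.
apply: (pack_count (att := busy_lo) (c := fun k => ~~ waiting eta k)) => [i m mK|].
  move=> /(src _ _ mK)[j ej [ij jm mj _]].
  by apply/waitingP => /(_ j jm mj); rewrite ej.
suff key i m i' m' : m < 2 * L + M + 1 -> m' < 2 * L + M + 1 ->
    busy_lo i m -> busy_lo i' m' -> i + m = i' + m' -> i < i' -> False.
  move=> i m i' m' mL mL' b b' e.
  case: (ltngtP i i') => // [/(key i m i' m' mL mL' b b' e)//|].
  by move=> /(key i' m' i m mL' mL b' b (esym e)).
move=> mK mK' b b' e ii'.
have [fi fi'] : first i /\ first i' by case/andP: b => ?; case/andP: b'.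
have [j ej [ij jm mj jL]] := src _ _ mK b.
have := first_gap fi fi' ii'; have /andP[/waitingP w _] := fi'.
have /andP[m0 _] : (0 < m') && true by case/andP: b' => _ /andP[->].
by move=> g; move: (w j); rewrite ej => H; apply/notF/H; lia.
Qed.

Lemma after_badN_count n K :
  \sum_(k < n) [exists b : 'I_k, (k <= b + K) && bad b]
    <= K * \sum_(k < n) bad k.
Proof.
apply: (@leq_trans (\sum_(i < n) \sum_(m < K) (fun b (m : nat) => bad b) i m)).
  apply: (@leq_trans (\sum_(k < n.+1) (if (k : nat) is k'.+1 then
      [exists b : 'I_k', (k' <= b + K) && bad b] else false))).
    by rewrite big_ord_recl.
  rewrite big_ord_recl add0n /=.
  have H : forall k, k < n -> [exists b : 'I_k, (k <= b + K) && bad b] ->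
     exists i m, [/\ m < K.+1, k = i + m & (0 < m) && bad i].
    move=> k kn /existsP[b /andP[kb bb]]; move: (ltn_ord b) => bk.
    by exists b, (k - b); rewrite bb; split; lia.
  apply: leq_trans (cover_count (att := fun i m => (0 < m) && bad i) H) _.
  by apply: leq_sum => i _; rewrite big_ord_recl /= add0n.
rewrite big_distrr /=; apply: leq_sum => i _.
by rewrite sum_nat_const card_ord.
Qed.

(** The reach [2 * L + M + 1] of a bad cell is [L], up to a kept cell stemming from it, plus the
    [L + M + 1] cells which that one inhibits. *)
Lemma busy_count_le n :
  \sum_(k < n) ~~ waiting eta k <=
  \sum_(i < n) \sum_(m < 2 * L + M + 2) busy_hi i m
  + (2 * L + M + 1) * \sum_(k < n) bad k.
Proof.
apply: leq_trans (leq_add (leqnn _) (after_badN_count n (2 * L + M + 1))).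
apply: (@leq_trans (\sum_(k < n) ((~~ waiting eta k &&
   ~~ [exists b : 'I_k, (k <= b + (2 * L + M + 1)) && bad b])
  + [exists b : 'I_k, (k <= b + (2 * L + M + 1)) && bad b]))).
  apply: leq_sum => k _.
  by case: (waiting eta k) => //=; case: [exists _, _].
rewrite big_split /= leq_add2r.
apply: (cover_count (att := busy_hi) (c := fun k => ~~ waiting eta k &&
  ~~ [exists b : 'I_k, (k <= b + (2 * L + M + 1)) && bad b])).
move=> k kn /andP[nw nb].
have [j [jk kj ej]] : exists j, [/\ j < k, k <= j + L + M + 1 & eta j].
  move: nw; rewrite negb_forall => /existsP[j]; rewrite negb_imply negbK.
  by move=> /andP[kj ej]; exists j.
case: (eta_source ej) => [[i fi ij]|[b bb bj]]; last first.
  exfalso; move/negP: nb; apply; apply/existsP.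
  have bk : b < k by lia.
  by exists (Ordinal bk); rewrite bb andbT /=; lia.
exists i, (k - i); split; [lia|lia|].
rewrite /busy_hi fi /=; apply/andP; split; first lia.
have [//|gt] := leqP (k - i) (L + M + 1); apply/occupiedP.
by exists j; [lia|exact: eta_xi].
Qed.

Lemma just_released_count n :
  \sum_(k < n) just_released k <= 2 * \sum_(k < n) eta k.
Proof.
pose att j m := eta j && ((m == L + M) || (m == L + M + 1)).
have H : forall k, k < n -> just_released k ->
    exists i m, [/\ m < L + M + 2, k = i + m & att i m].
  move=> k kn /just_releasedP[j kj ej]; exists j, (k - j).
  by rewrite /att ej; split; lia.
apply: leq_trans (cover_count H) _; rewrite big_distrr /=.
apply: leq_sum => i _; rewrite /att; case: (eta i); last by rewrite big1.
have l0 : L + M < L + M + 2 by lia.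
have l1 : L + M + 1 < L + M + 2 by lia.
rewrite (bigD1 (Ordinal l0)) //= (bigD1 (Ordinal l1)) /=; last first.
  by apply/eqP => /(congr1 val) /=; lia.
rewrite big1 ?addn0 ?eqxx ?orbT //= => m /andP[/eqP m0 /eqP m1].
case: eqP => [e|_]; first by exfalso; apply: m0; exact: val_inj.
by case: eqP => [e|//]; exfalso; apply: m1; exact: val_inj.
Qed.

Lemma after_bad_count n : \sum_(k < n) after_bad k <= L * \sum_(k < n) bad k.
Proof. exact: after_badN_count. Qed.

End discrete_dynamics.

(** * Asymptotic densities up to sublinear errors *)

Section sublinear.
Variable R : realType.
Implicit Types u v : nat -> R.

Definition sublinear u := (fun n => u n / n%:R) @ \oo --> (0 : R).

Lemma sublinear_ext u v : u =1 v -> sublinear u -> sublinear v.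
Proof. by move=> /funext ->. Qed.

Lemma sublinearD u v :
  sublinear u -> sublinear v -> sublinear (fun n => u n + v n).
Proof.
move=> su sv; rewrite /sublinear -(addr0 (0 : R)).
under eq_fun do rewrite mulrDl.
exact: cvgD.
Qed.

Lemma sublinearZ c u : sublinear u -> sublinear (fun n => c * u n).
Proof.
move=> su; rewrite /sublinear -(mulr0 c).
under eq_fun do rewrite -mulrA.
exact: cvgMr.
Qed.

Lemma sublinearB u v :
  sublinear u -> sublinear v -> sublinear (fun n => u n - v n).
Proof.
move=> su sv; have := sublinearD su (sublinearZ (-1) sv).
by apply: sublinear_ext => n; rewrite mulN1r.
Qed.

Lemma sublinear_cst c : sublinear (fun=> c).
Proof.
rewrite /sublinear -(mulr0 c); apply: cvgMr.
by rewrite -cvg_shiftS; exact: cvg_harmonic.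
Qed.

Lemma sublinear_norm u : sublinear u -> sublinear (fun n => `|u n|).
Proof.
move=> su; rewrite /sublinear -(@normr0 _ R).
under eq_fun => n do rewrite -[X in _ / X]ger0_norm // -normf_div.
exact: cvg_norm.
Qed.

Lemma sublinear_sum (K : nat) (u : 'I_K -> nat -> R) :
  (forall m, sublinear (u m)) -> sublinear (fun n => \sum_(m < K) u m n).
Proof.
move=> H.
elim: K u H => [|K IH] u H.
  by apply: sublinear_ext (sublinear_cst 0) => n; rewrite big_ord0.
apply: sublinear_ext (sublinearD (IH _ (fun m => H (widen_ord (leqnSn K) m)))
  (H ord_max)) => n.
by rewrite big_ord_recr.
Qed.

End sublinear.

(** * Density of cycles and of kept cells *)

Section discrete_limit.
Variables (R : realType) (L M : nat) (xi eta : nat -> bool) (q : R).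
Hypothesis LM : (L < M)%N.
Hypothesis eta_xi : forall k, eta k -> xi k.
Hypothesis eta_block : forall j k,
  (j + L < k)%N -> (k < j + L + M)%N -> eta j -> ~~ eta k.
Hypothesis eta_accept : forall k, xi k ->
  (forall j, j < k -> j + L <= k -> k <= j + L + M + 1 -> ~~ eta j)%N -> eta k.
Hypotheses (q0 : 0 < q) (q1 : q < 1).

Let p : R := 1 - q.
Let first := first L M eta.
Let waiting := waiting L M eta.
Let just_released := just_released L M eta.
Let bad := bad L M xi eta.
Let after_bad := after_bad L M xi eta.
Let count (c : nat -> bool) n : R := \sum_(k < n) (c k)%:R.

(** A conditional law of large numbers in centred form: unlike a ratio of counts, it keeps a meaning
    when [H] has density zero. *)
Definition averages_to (H Z : nat -> bool) (z : R) :=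
  sublinear (fun n => \sum_(k < n) (H k)%:R * ((Z k)%:R - z)).

(** These two hypotheses are the whole probabilistic input. The events [H k] listed here are decided
    before the cell [k], whereas [first k] is decided only at its end, whence [0 < a] in the second
    one. *)
Hypothesis xi_avg : forall H, H = xpredT \/ H = waiting \/ H = just_released
  \/ H = after_bad -> averages_to H xi p.
Hypothesis occupied_avg : forall a l, (0 < a)%N ->
  averages_to first (fun k => occupied xi (k + a) l) (1 - q ^+ l).

(* Mean number of cells from the first to the last hit of a window of L cells. *)
Definition busy_mean : R := \sum_(j < L) (1 - q ^+ (L - j)).

Let p0 : 0 < p. Proof. by rewrite /p subr_gt0. Qed.

Lemma averages_toE H Z z : averages_to H Z z ->
  exists2 v, sublinear v &
    forall n, count (fun k => H k && Z k) n = z * count H n + v n.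
Proof.
move=> A; eexists; first exact: A.
move=> n; rewrite /count mulr_sumr -big_split; apply: eq_bigr => k _ /=.
by case: (H k); case: (Z k) => /=; ring.
Qed.

Lemma averages_sum (K : nat) (Z : nat -> nat -> bool) (z : nat -> R) :
  (forall m, (m < K)%N -> averages_to first (Z^~ m) (z m)) ->
  exists2 v, sublinear v & forall n,
    (\sum_(i < n) \sum_(m < K) (first i && Z i m))%N%:R
      = (\sum_(m < K) z m) * count first n + v n.
Proof.
move=> A; exists (fun n => \sum_(m < K)
    \sum_(k < n) (first k)%:R * ((Z k m)%:R - z m)).
  by apply: sublinear_sum => m; exact: A.
move=> n; rewrite exchange_big natr_sum mulr_suml -big_split.
apply: eq_bigr => m _; rewrite natr_sum /count mulr_sumr -big_split.
by apply: eq_bigr => k _ /=; case: (first k); case: (Z k m) => /=; ring.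
Qed.

Lemma averages_true H : averages_to H xpredT 1.
Proof.
apply: sublinear_ext (sublinear_cst 0) => n.
by rewrite big1 // => k _; rewrite subrr mulr0.
Qed.

Lemma averages_false H : averages_to H xpred0 0.
Proof.
apply: sublinear_ext (sublinear_cst 0) => n.
by rewrite big1 // => k _; rewrite subrr mulr0.
Qed.

Lemma averages_ext H Z Z' z : Z =1 Z' -> averages_to H Z z -> averages_to H Z' z.
Proof. by move=> /funext ->. Qed.

Lemma occupied1 a : occupied xi a 1 = xi a.
Proof.
apply/idP/idP => [/occupiedP[j ja]|xa]; last by apply/occupiedP; exists a => //; lia.
by have -> : j = a by lia.
Qed.

Lemma xi_after_avg m : (0 < m)%N -> averages_to first (fun k => xi (k + m)) p.
Proof.
move=> m0; have := occupied_avg 1 m0; rewrite expr1.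
by apply: averages_ext => k; exact: occupied1.
Qed.

Lemma count_shift (c : nat -> bool) n K :
  (\sum_(k < n + K) c k <= \sum_(k < n) c k + K)%N.
Proof.
rewrite big_split_ord /= leq_add2l.
apply: (leq_trans (leq_sum _ (fun i _ => leq_b1 _))).
by rewrite sum_nat_const card_ord muln1.
Qed.

Lemma countE c n : count c n = (\sum_(k < n) c k)%N%:R.
Proof. by rewrite /count natr_sum. Qed.

Lemma eta_count_lower : exists2 v, sublinear v & forall n,
  (1 + L%:R * p - p) * count first n <= count eta n + v n.
Proof.
pose Z i m := (m == 0) || ((m < L)%N && xi (i + m)).
pose z m : R := if m == 0%N then 1 else if (m < L)%N then p else 0.
have [|v sv E] := @averages_sum L.+1 Z z.
  move=> m _; rewrite /Z /z; case: (posnP m) => [->|m0].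
    exact: averages_true.
  rewrite /=; case: (m < L)%N; last exact: averages_false.
  exact: xi_after_avg.
exists (fun n => L.+1%:R - v n).
  by apply: sublinearB => //; exact: sublinear_cst.
move=> n; have := eta_count_ge LM eta_accept n.
move/leq_trans => /(_ _ (count_shift _ _ _)).
rewrite -(ler_nat R) E natrD -countE => H.
(* Equality for [L > 0]: offset 0, then [L - 1] offsets of mean [p]. For [L = 0] the sum is 1 and
   the coefficient [1 - p]. *)
have zge : 1 + L%:R * p - p <= \sum_(m < L.+1) z m.
  rewrite big_ord_recl /= /z /=; case: L => [|L']; first by rewrite big_ord0 mul0r !addr0 gerBl ltW.
  rewrite big_ord_recr /= /bump /= ?add1n ltnn.
  rewrite (eq_bigr (fun=> p)); last first.
    by move=> i _; rewrite /= /bump /= !add1n ltnS ltn_ord.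
  by rewrite sumr_const card_ord -(mulr_natl p) -natr1; lra.
have c0 : 0 <= count first n by apply: sumr_ge0.
by have := ler_wpM2r c0 zge; lra.
Qed.

Lemma busy_split K (z : nat -> R) :
  \sum_(m < K.+1 + L) z m = z 0%N + \sum_(m < K) z m.+1 + \sum_(j < L) z (K.+1 + j)%N.
Proof. by rewrite big_split_ord /= big_ord_recl. Qed.

Lemma busy_lower : exists2 v, sublinear v & forall n,
  count waiting n + ((L + M)%:R + busy_mean) * count first n <= n%:R + v n.
Proof.
pose Z i m := (0 < m)%N && ((m <= L + M + 1)%N ||
  occupied xi (i + (m - (L + M + 1))) (2 * L + M + 1 - m)).
pose z m : R := if m == 0%N then 0 else if (m <= L + M + 1)%N then 1
  else 1 - q ^+ (2 * L + M + 1 - m).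
have [|v sv E] := @averages_sum (2 * L + M + 1) Z z.
  move=> m _; rewrite /Z /z; case: (posnP m) => [->|m0].
    exact: averages_false.
  case: leqP => mle /=; first exact: averages_true.
  by apply: occupied_avg; lia.
exists (fun n => (2 * L + M + 1)%:R - v n).
  by apply: sublinearB => //; exact: sublinear_cst.
move=> n; have := busy_count_ge LM eta_accept n.
move/leq_trans => /(_ _ (count_shift (fun k => ~~ waiting k) _ _)).
rewrite -(ler_nat R) E natrD -(countE (fun k => ~~ waiting k)) => H.
have cw : count waiting n + count (fun k => ~~ waiting k) n = n%:R.
  rewrite /count -big_split /= (eq_bigr (fun=> 1)).
    by rewrite sumr_const card_ord.
  by move=> k _; case: (waiting k); rewrite ?addr0 ?add0r.
have zge : (L + M)%:R + busy_mean <= \sum_(m < 2 * L + M + 1) z m.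
  have -> : (2 * L + M + 1 = (L + M).+1 + L)%N by lia.
  rewrite busy_split {1}/z eqxx add0r; apply: lerD.
    rewrite (eq_bigr (fun=> 1)) ?sumr_const ?card_ord //.
    by move=> i _; rewrite /z /= ifT //; move: (ltn_ord i); lia.
  (* The terms agree except at [j = 0], the offset [L + M + 1], which is certainly busy and so
     contributes 1. *)
  apply: ler_sum => j _; rewrite /z /=; case: leqP => jle; last by rewrite gerBl exprn_ge0 // ltW.
  by rewrite (_ : (2 * L + M + 1 - _ = L - j)%N) //; lia.
have c0 : 0 <= count first n by apply: sumr_ge0.
by have := ler_wpM2r c0 zge; lra.
Qed.

Lemma busy_upper : exists2 v, sublinear v & forall n,
  n%:R <= count waiting n + ((L + M + 1)%:R + busy_mean) * count first n
     + (2 * L + M + 1)%:R * count bad n + v n.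
Proof.
pose Z i m := (0 < m)%N && ((m <= L + M + 1)%N ||
  occupied xi (i + (m - (L + M + 1))) (2 * L + M + 2 - m)).
pose z m : R := if m == 0%N then 0 else if (m <= L + M + 1)%N then 1
  else 1 - q ^+ (2 * L + M + 2 - m).
have [|v sv E] := @averages_sum (2 * L + M + 2) Z z.
  move=> m _; rewrite /Z /z; case: (posnP m) => [->|m0].
    exact: averages_false.
  case: leqP => mle /=; first exact: averages_true.
  by apply: occupied_avg; lia.
exists v => // n; have := busy_count_le LM eta_xi eta_block n.
rewrite -(ler_nat R) natrD natrM E -countE -(countE (fun k => ~~ waiting k)) => H.
have cw : count waiting n + count (fun k => ~~ waiting k) n = n%:R.
  rewrite /count -big_split /= (eq_bigr (fun=> 1)).
    by rewrite sumr_const card_ord.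
  by move=> k _; case: (waiting k); rewrite ?addr0 ?add0r.
have zE : \sum_(m < 2 * L + M + 2) z m = (L + M + 1)%:R + busy_mean.
  have -> : (2 * L + M + 2 = (L + M + 1).+1 + L)%N by lia.
  rewrite busy_split {1}/z eqxx add0r; congr (_ + _).
    rewrite (eq_bigr (fun=> 1)) ?sumr_const ?card_ord //.
    by move=> i _; rewrite /z /= ifT //; move: (ltn_ord i); lia.
  apply: eq_bigr => j _; rewrite /z ifF; last by lia.
  by rewrite (_ : (_ - _ = L - j)%N) //; lia.
by rewrite -zE -cw; move: H; rewrite -/waiting -/bad; lra.
Qed.

(** One factor [p] is the chance that a just released cell is charged, the other bounds the density
    of kept cells by that of charged ones. The order delta^2 survives the factor [2 * L + M + 1], of
    order 1/delta, in [busy_upper]. *)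
Lemma bad_upper : exists2 v, sublinear v & forall n,
  count bad n <= 2 * p ^+ 2 * n%:R + v n.
Proof.
have [v1 s1 E1] := averages_toE (xi_avg (or_intror (or_intror (or_introl erefl)))).
have [v2 s2 E2] := averages_toE (xi_avg (or_introl erefl)).
exists (fun n => v1 n + 2 * p * v2 n).
  by apply: sublinearD => //; exact: sublinearZ.
move=> n; rewrite E1.
have := just_released_count eta LM n; rewrite -(ler_nat R) natrM -!countE => H.
have Yx : count eta n <= count xi n.
  by apply: ler_sum => k _; rewrite ler_nat; have [/eta_xi->|] := boolP (eta k).
have X : count xi n = p * n%:R + v2 n.
  have -> : count xi n = count (fun k => true && xi k) n by [].
  rewrite E2 /count; congr (p * _ + _).
  by rewrite sumr_const card_ord.
have : p * count just_released n <= p * (2 * (p * n%:R + v2 n)).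
  by apply: ler_wpM2l; [exact: ltW|rewrite -X; move: H; rewrite -/just_released; lra].
by rewrite expr2; lra.
Qed.

(** Cells after a bad one count only when charged, with weight [p] by the averaging hypothesis. The
    cruder bound by [L] times the bad cells would, for [r > 0], be of the same order delta as the
    density of kept cells itself. *)
Lemma eta_count_upper : exists2 v, sublinear v & forall n,
  count eta n <= (1 + L%:R * p) * count first n + (1 + L%:R * p) * count bad n
    + v n.
Proof.
pose Z i m := (m == 0%N) || xi (i + m).
pose z m : R := if m == 0%N then 1 else p.
have [|v sv E] := @averages_sum L.+1 Z z.
  move=> m _; rewrite /Z /z; case: (posnP m) => [->|m0].
    exact: averages_true.
  exact: xi_after_avg.
have [v1 s1 E1] := averages_toE (xi_avg (or_intror (or_intror (or_intror erefl)))).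
exists (fun n => v n + v1 n); first exact: sublinearD.
move=> n; have := eta_count_le LM eta_xi eta_block n.
rewrite -(ler_nat R) !natrD E -!countE -(countE (fun k => after_bad k && xi k)) E1 => H.
have := after_bad_count xi eta LM n; rewrite -(ler_nat R) natrM -!countE.
move/(ler_wpM2l (ltW p0)) => H'.
have zE : \sum_(m < L.+1) z m = 1 + L%:R * p.
  by rewrite big_ord_recl /= /z /= sumr_const card_ord mulr_natl.
by move: H H'; rewrite zE -/bad -/after_bad; lra.
Qed.

Definition cycle_cells : R := p^-1 + (L + M)%:R + busy_mean.

Lemma busy_mean_ge0 : 0 <= busy_mean.
Proof. by apply: sumr_ge0 => j _; rewrite subr_ge0 exprn_ile1 ?ltW. Qed.

(* If f is the density of cycles, [cycle_cells * f] is 1 up to the bad cells, the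
   density of waiting cells being [f / p]. *)
Theorem discrete_density : exists2 v, sublinear v & forall n,
  (1 + L%:R * p - p) *
     ((1 - 2 * (2 * L + M + 1)%:R * p ^+ 2) / (cycle_cells + 1)) * n%:R - v n
    <= count eta n
    <= (1 + L%:R * p) * (cycle_cells^-1 + 2 * p ^+ 2) * n%:R + v n.
Proof.
have [v1 s1 E1] := eta_count_lower.
have [v2 s2 E2] := busy_lower.
have [v3 s3 E3] := busy_upper.
have [v4 s4 E4] := bad_upper.
have [v5 s5 E5] := eta_count_upper.
have [v6 s6 E6] := averages_toE (xi_avg (or_intror (or_introl erefl))).
have c0 : 0 < cycle_cells.
  by rewrite /cycle_cells -addrA ltr_pwDl ?invr_gt0 // addr_ge0 // busy_mean_ge0.
have F n : count first n = p * count waiting n + v6 n.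
  by rewrite -E6 /count; apply: eq_bigr => k _; rewrite /first (firstE eta_xi eta_accept).
have W n : count waiting n = p^-1 * count first n - p^-1 * v6 n.
  by rewrite F mulrDr mulrA mulVf ?gt_eqF // mul1r addrK.
pose w1 n := p^-1 * v6 n + v2 n.
have U n : count first n <= n%:R / cycle_cells + cycle_cells^-1 * w1 n.
  rewrite [_ * w1 n]mulrC -mulrDl ler_pdivlMr // mulrC.
  by have := E2 n; rewrite W /cycle_cells /w1; lra.
pose c := (2 * L + M + 1)%:R : R.
pose w2 n := p^-1 * v6 n - c * v4 n - v3 n.
(* The added 1 is the extra busy cell of the upper attribution; [2 * c * p ^+ 2] is the proportion
   of cells spoiled by bad ones. *)
have V n : (1 - 2 * c * p ^+ 2) / (cycle_cells + 1) * n%:R + (cycle_cells + 1)^-1 * w2 n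
    <= count first n.
  have c1 : 0 < cycle_cells + 1 by rewrite ltr_wpDr.
  rewrite mulrAC [_ * w2 n]mulrC -mulrDl ler_pdivrMr // mulrC.
  have := E3 n; have := ler_wpM2l (ler0n R (2 * L + M + 1)) (E4 n).
  by rewrite W /cycle_cells /w2 -/c natrD; lra.
have k0 : 0 <= 1 + L%:R * p - p.
  have p1 : p < 1 by rewrite /p gtrBl.
  by have := mulr_ge0 (ler0n R L) (ltW p0); lra.
have k1 : 0 <= 1 + L%:R * p by rewrite addr_ge0 // mulr_ge0 // ltW.
exists (fun n => `|v1 n - (1 + L%:R * p - p) * ((cycle_cells + 1)^-1 * w2 n)| +
    `|(1 + L%:R * p) * (cycle_cells^-1 * w1 n + v4 n) + v5 n|).
  apply: sublinearD; apply: sublinear_norm.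
    apply: sublinearB => //; do 2!apply: sublinearZ.
    by apply: sublinearB => //; apply: sublinearB; exact: sublinearZ.
  apply: sublinearD => //; apply: sublinearZ; apply: sublinearD => //.
  by apply: sublinearZ; apply: sublinearD => //; exact: sublinearZ.
move=> n; apply/andP; split.
  have := ler_wpM2l k0 (V n); have := E1 n.
  have := ler_norm (v1 n - (1 + L%:R * p - p) * ((cycle_cells + 1)^-1 * w2 n)).
  have := normr_ge0 ((1 + L%:R * p) * (cycle_cells^-1 * w1 n + v4 n) + v5 n).
  by rewrite /c; lra.
have := ler_wpM2l k1 (U n); have := ler_wpM2l k1 (E4 n); have := E5 n.
have := normr_ge0 (v1 n - (1 + L%:R * p - p) * ((cycle_cells + 1)^-1 * w2 n)).
have := ler_norm ((1 + L%:R * p) * (cycle_cells^-1 * w1 n + v4 n) + v5 n).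
by lra.
Qed.
End discrete_limit.

(** * A law of large numbers *)

Section bounded_variables.
Context (d : measure_display) (T : measurableType d) (R : realType)
  (P : probability T R).
Implicit Types f g : T -> R.

Definition bounded_rv f :=
  measurable_fun setT f /\ exists c : R, forall w, `|f w| <= c.

Lemma bounded_rv_integrable f : bounded_rv f -> P.-integrable setT (EFin \o f).
Proof.
move=> [mf [c fc]]; apply: measurable_bounded_integrable => //.
  by rewrite (le_lt_trans (probability_le1 _ _)) // ltry.
exists c; split; first exact: num_real.
by move=> x cx w _; exact: le_trans (fc w) (ltW cx).
Qed.

Lemma bounded_rvD f g :
  bounded_rv f -> bounded_rv g -> bounded_rv (fun w => f w + g w).
Proof.
move=> [mf [c fc]] [mg [e ge]]; split; first exact: measurable_funD.
by exists (c + e) => w; rewrite (le_trans (ler_normD _ _)) // lerD.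
Qed.

Lemma bounded_rvM f g :
  bounded_rv f -> bounded_rv g -> bounded_rv (fun w => f w * g w).
Proof.
move=> [mf [c fc]] [mg [e ge]]; split; first exact: measurable_funM.
by exists (c * e) => w; rewrite normrM ler_pM.
Qed.

Lemma bounded_rv_cst c : bounded_rv (cst c).
Proof. by split=> //; exists `|c|. Qed.

Lemma bounded_rv_indic (A : set T) : measurable A -> bounded_rv (\1_A).
Proof.
move=> mA; split; first exact: measurable_indic.
by exists 1 => w; rewrite indicE; case: (_ \in _); rewrite ?normr1 ?normr0.
Qed.

Lemma bounded_rv_sum n (X : nat -> T -> R) :
  (forall k, bounded_rv (X k)) -> bounded_rv (fun w => \sum_(k < n) X k w).
Proof.
move=> bX; elim: n => [|n IH].
  by under eq_fun do rewrite big_ord0; exact: bounded_rv_cst.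
by under eq_fun do rewrite big_ord_recr; exact: bounded_rvD.
Qed.

Definition mean f : R := \int[P]_w f w.

Lemma meanD f g : bounded_rv f -> bounded_rv g ->
  mean (fun w => f w + g w) = mean f + mean g.
Proof. by move=> bf bg; apply: RintegralD => //; exact: bounded_rv_integrable. Qed.

Lemma meanZ c f : bounded_rv f -> mean (fun w => c * f w) = c * mean f.
Proof. by move=> bf; apply: RintegralZl => //; exact: bounded_rv_integrable. Qed.

Lemma mean_cst c : mean (cst c) = c.
Proof.
rewrite /mean Rintegral_cst // [X in fine X](_ : _ = 1%E) ?mulr1 //.
exact: probability_setT.
Qed.

Lemma mean_indic (A : set T) : measurable A -> mean (\1_A) = fine (P A).
Proof. by move=> mA; rewrite /mean /Rintegral integral_indic // setIT. Qed.

Lemma mean_le f g : bounded_rv f -> bounded_rv g -> (forall w, f w <= g w) ->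
  mean f <= mean g.
Proof.
by move=> bf bg fg; apply: le_Rintegral => //; exact: bounded_rv_integrable.
Qed.

Lemma mean_EFin f : bounded_rv f -> (\int[P]_w (f w)%:E)%E = (mean f)%:E.
Proof.
move=> bf; rewrite /mean /Rintegral fineK //.
by apply: integrable_fin_num => //; exact: bounded_rv_integrable.
Qed.

Lemma mean_sum n (X : nat -> T -> R) : (forall k, bounded_rv (X k)) ->
  mean (fun w => \sum_(k < n) X k w) = \sum_(k < n) mean (X k).
Proof.
move=> bX; elim: n => [|n IH].
  by rewrite big_ord0; under [X in mean X]eq_fun do rewrite big_ord0; exact: mean_cst.
under [X in mean X]eq_fun do rewrite big_ord_recr.
rewrite (meanD (f := fun w => \sum_(k < n) X k w)) ?IH ?big_ord_recr //.
exact: bounded_rv_sum.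
Qed.

End bounded_variables.

Lemma overlap_count a m n : (\sum_(j < n) (a < j + m) <= n + m - a)%N.
Proof.
elim: n => [|n IH]; first by rewrite big_ord0.
rewrite big_ord_recr /=; move: IH; set s := (\sum_(j < n) _)%N.
by case: (ltnP a (n + m)) => /=; lia.
Qed.

Lemma sum_inv_sqr_le (R : realType) n :
  \sum_(i < n) (i.+1%:R ^+ 2)^-1 <= 2 - 2 / n.+1%:R :> R.
Proof.
elim: n => [|n IH]; first by rewrite big_ord0 invr1; lra.
rewrite big_ord_recr /= (le_trans (lerD IH (lexx _))) //.
have x1 : (1 : R) <= n.+1%:R by rewrite ler1n.
rewrite -[n.+2%:R]natr1; set x := n.+1%:R : R in x1 *.
have x0 : 0 < x by lra.
rewrite -subr_ge0 (_ : _ - _ = (x - 1) / (x ^+ 2 * (x + 1))).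
  by rewrite divr_ge0 ?mulr_ge0 ?exprn_ge0 //; lra.
by field; rewrite ?gt_eqF //=; lra.
Qed.

Section weak_dependence.
Context (d : measure_display) (T : measurableType d) (R : realType)
  (P : probability T R).
Variables (m : nat) (X : nat -> T -> R).
Hypothesis mX : forall k, measurable_fun setT (X k).
Hypothesis X1 : forall k w, `|X k w| <= 1.
Hypothesis orthX : forall j k, (j + m <= k)%N -> mean P (fun w => X j w * X k w) = 0.

Let S n w := \sum_(k < n) X k w.

Let bX k : bounded_rv (X k). Proof. by split => //; exists 1. Qed.
Let bS n : bounded_rv (S n). Proof. exact: bounded_rv_sum. Qed.

(** Each new variable is orthogonal to all but the last [m], so it adds at most [2 * m] through
    cross terms and 1 through its square. *)
Lemma second_moment_le n : mean P (fun w => S n w ^+ 2) <= (2 * m + 1)%:R * n%:R.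
Proof.
elim: n => [|n IH].
  rewrite mulr0 (_ : (fun _ => _) = cst 0) ?mean_cst //.
  by apply/funext => w; rewrite /S big_ord0 expr0n.
have XX j k : mean P (fun w => X j w * X k w) <= 1.
  rewrite -[leRHS](mean_cst P); apply: mean_le => [||w].
  - exact: bounded_rvM.
  - exact: bounded_rv_cst.
  - by rewrite (le_trans (ler_norm _)) // normrM mulr_ile1.
have SX : mean P (fun w => S n w * X n w) <= m%:R.
  rewrite (_ : (fun _ => _) = fun w => \sum_(j < n) X j w * X n w); last first.
    by apply/funext => w; rewrite mulr_suml.
  rewrite (mean_sum P n (X := fun j w => X j w * X n w)); last first.
    by move=> k; exact: bounded_rvM.
  apply: (@le_trans _ _ (\sum_(j < n) (n < j + m)%N%:R)); last first.
    rewrite -natr_sum ler_nat (leq_trans (overlap_count n m n)) //; lia.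
  apply: ler_sum => j _; case: ltnP => [_|/orthX->//]; exact: XX.
rewrite (_ : (fun _ => _) = fun w => S n w ^+ 2 +
    (2 * (S n w * X n w) + X n w * X n w)); last first.
  by apply/funext => w; rewrite /S big_ord_recr /=; ring.
have b1 : bounded_rv (fun w => S n w ^+ 2).
  by under eq_fun do rewrite expr2; exact: bounded_rvM.
have b2 : bounded_rv (fun w => S n w * X n w) by exact: bounded_rvM.
have b3 : bounded_rv (fun w => 2 * (S n w * X n w)).
  by apply: bounded_rvM => //; exact: bounded_rv_cst.
have b4 : bounded_rv (fun w => X n w * X n w) by exact: bounded_rvM.
rewrite meanD //; last exact: bounded_rvD.
rewrite meanD // meanZ //.
rewrite -[n.+1%:R]natr1 mulrDr mulr1 lerD // natrD natrM.
by have := XX n n; lra.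
Qed.

Let Y i w := (S (i.+1 ^ 2) w / (i.+1 ^ 2)%:R) ^+ 2.

(** The mean square of [S n / n] is of order 1/n, which is summable along the squares. The series of
    the [Y i] then has finite mean, so it converges almost surely and its terms vanish. *)
Lemma square_averages_cvg : {ae P, forall w, Y^~ w @ \oo --> 0}.
Proof.
have bY i : bounded_rv (Y i).
  rewrite /Y; under eq_fun do rewrite expr2.
  by do !apply: bounded_rvM => //; exact: bounded_rv_cst.
have Y0 i w : 0 <= Y i w by exact: sqr_ge0.
have EY i : mean P (Y i) <= (2 * m + 1)%:R * (i.+1%:R ^+ 2)^-1.
  rewrite (_ : Y i = fun w => ((i.+1 ^ 2)%:R ^+ 2)^-1 * S (i.+1 ^ 2) w ^+ 2); last first.
    by apply/funext => w; rewrite /Y exprMn exprVn mulrC.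
  rewrite meanZ; last by under eq_fun do rewrite expr2; exact: bounded_rvM.
  have a0 : (0 : R) < (i.+1 ^ 2)%:R by rewrite ltr0n expn_gt0.
  have b0 : (0 : R) <= ((i.+1 ^ 2)%:R ^+ 2)^-1 by rewrite invr_ge0 exprn_ge0 // ltW.
  apply: (le_trans (ler_wpM2l b0 (second_moment_le _))).
  rewrite natrX; have x0 : i.+1%:R != 0 :> R by rewrite pnatr_eq0.
  rewrite le_eqVlt; apply/orP; left; apply/eqP.
  by field; rewrite ?x0 //.
have : (\int[P]_w (\sum_(i <oo) (Y i w)%:E) < +oo)%E.
  rewrite integral_nneseries //; last 2 first.
  - by move=> i; apply/measurable_EFinP; case: (bY i).
  - by move=> i w _; rewrite lee_fin.
  apply: (@le_lt_trans _ _ ((2 * m + 1)%:R * 2)%:E); last exact: ltry.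
  apply: lime_le.
    by apply: is_cvg_nneseries => i _ _; apply: integral_ge0 => w _; rewrite lee_fin.
  apply: nearW => n; rewrite big_mkord.
  rewrite (eq_bigr (fun i : 'I_n => (mean P (Y i))%:E)); last first.
    by move=> i _; rewrite mean_EFin.
  rewrite sumEFin lee_fin (le_trans (ler_sum _ (fun (i : 'I_n) _ => EY i))) //.
  rewrite -mulr_sumr ler_wpM2l // (le_trans (sum_inv_sqr_le _ _)) //.
  by rewrite gerBl divr_ge0.
move=> fin; have mser : measurable_fun setT (fun w => \sum_(i <oo) (Y i w)%:E)%E.
  apply: ge0_emeasurable_sum => [i w _ _|i _]; first by rewrite lee_fin.
  by apply/measurable_EFinP; case: (bY i).
have int : P.-integrable setT (fun w => \sum_(i <oo) (Y i w)%:E)%E.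
  apply/integrableP; split => //.
  rewrite (eq_integral (fun w => \sum_(i <oo) (Y i w)%:E)%E) // => w _.
  by rewrite gee0_abs //; apply: nneseries_ge0 => i _ _; rewrite lee_fin.
have := integrable_ae measurableT int; apply: filterS => w /(_ I) finw.
have lty : (\sum_(i <oo) (Y i w)%:E < +oo)%E.
  by rewrite ltey_eq finw.
have tail := nneseries_tail_cvg lty (fun k _ => (Y0 k w : (0 <= (Y k w)%:E)%E)).
have : (Y i w)%:E @[i --> \oo] --> 0%E.
  apply: (squeeze_cvge _ (cvg_cst 0%E) tail).
  apply: nearW => n; rewrite lee_fin Y0 /=.
  have := @nneseries_lim_ge R (fun k => (Y k w)%:E) xpredT n n.+1.
  by rewrite big_nat1; apply => k _ _; rewrite lee_fin.
by move/fine_cvgP => [].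
Qed.

(** Between the squares of [i + 1] and [i + 2] there are fewer than [3 * (i + 1)] variables, each
    bounded by 1, which is negligible before [(i + 1)^2]. *)
Theorem weakly_dependent_lln : {ae P, forall w, sublinear (fun n => \sum_(k < n) X k w)}.
Proof.
have := square_averages_cvg; apply: filterS => w cY.
apply/cvgrPdist_le => e e0.
have e2 : 0 < (e / 2) ^+ 2 by rewrite exprn_gt0 // divr_gt0.
have [N1 _ H1] : \forall i \near \oo, Y i w <= (e / 2) ^+ 2.
  move/cvgrPdist_le : cY => /(_ _ e2); apply: filterS => i.
  by rewrite sub0r normrN => /(le_trans (ler_norm _)).
(* With [x = i + 1], the condition [1 / x <= e / 6] says that the gap [3 * x] is at most
   [e / 2 * x ^+ 2]. *)
have e6 : 0 < e / 6 by rewrite divr_gt0.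
have [N2 _ H2] : \forall i \near \oo, harmonic i <= e / 6 :> R.
  have /cvgrPdist_le/(_ _ e6) := @cvg_harmonic R; apply: filterS => i.
  by rewrite sub0r normrN => /(le_trans (ler_norm _)).
exists ((N1 + N2).+1 ^ 2)%N => // n /= Nn.
rewrite sub0r normrN.
have exP : exists i, (i.+1 ^ 2 <= n)%N by exists (N1 + N2)%N.
have boundP i : (i.+1 ^ 2 <= n -> i <= n)%N by rewrite expnS expn1; nia.
case: (ex_maxnP exP boundP) => i ileq imax.
have iN : (N1 + N2 <= i)%N by exact: imax.
have nlt : (n < i.+2 ^ 2)%N.
  by rewrite ltnNge; apply/negP => /imax; rewrite ltnn.
have n0 : 0 < n%:R :> R by rewrite ltr0n; move: ileq; rewrite expnS expn1; nia.
rewrite normf_div [X in _ / X]ger0_norm ?(ltW n0) // ler_pdivrMr //.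
have x1 : 1 <= i.+1%:R :> R by rewrite ler1n.
set x := i.+1%:R : R in x1; have x0 : 0 < x by lra.
have ySq : `|S (i.+1 ^ 2) w| <= e / 2 * x ^+ 2.
  have : Y i w <= (e / 2) ^+ 2 by apply: H1 => /=; lia.
  rewrite /Y -[(_ / _) ^+ 2]real_normK ?num_real // ler_sqr ?nnegrE ?(ltW (divr_gt0 e0 _)) //.
  rewrite normf_div.
  by rewrite natrX -/x [`|x ^+ 2|]ger0_norm ?sqr_ge0 // ler_pdivrMr ?exprn_gt0.
have xe : 3 * x <= e / 2 * x ^+ 2.
  have : harmonic i <= e / 6 by apply: H2 => /=; lia.
  rewrite /harmonic /= -/x -(ler_pM2r x0) mulVf ?gt_eqF // => h.
  by rewrite expr2; nra.
have nE : (n = i.+1 ^ 2 + (n - i.+1 ^ 2))%N by rewrite subnKC.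
rewrite nE big_split_ord /= (le_trans (ler_normD _ _)) //.
have tail : `|\sum_(k < n - i.+1 ^ 2) X (i.+1 ^ 2 + k) w| <= 3 * x.
  apply: (le_trans (ler_norm_sum _ _ _)).
  apply: (@le_trans _ _ (\sum_(k < n - i.+1 ^ 2) 1)); first exact: ler_sum.
  rewrite sumr_const card_ord /x -natrM ler_nat.
  by move: nlt ileq; rewrite !expnS !expn0 !muln1; nia.
rewrite -nE; have : x ^+ 2 <= n%:R by rewrite /x -natrX ler_nat.
by move: ySq; rewrite /S; nra.
Qed.

End weak_dependence.

Section events_lln.
Context (d : measure_display) (T : measurableType d) (R : realType)
  (P : probability T R).

(** Expanding the product of two centred terms leaves four probabilities; the two product formulas,
    for the past events with and without [Z j], cancel them in pairs. *)
Lemma events_lln (m : nat) (H Z : nat -> set T) (p : R) :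
  (forall k, measurable (H k)) -> (forall k, measurable (Z k)) ->
  0 <= p <= 1 ->
  (forall j k, (j + m <= k)%N ->
     P (H j `&` Z j `&` H k `&` Z k) = (P (H j `&` Z j `&` H k) * p%:E)%E) ->
  (forall j k, (j + m <= k)%N ->
     P (H j `&` H k `&` Z k) = (P (H j `&` H k) * p%:E)%E) ->
  {ae P, forall w, sublinear (fun n => \sum_(k < n) \1_(H k) w * (\1_(Z k) w - p))}.
Proof.
move=> mH mZ /andP[p0 p1] I1 I2.
apply: (@weakly_dependent_lln _ _ _ P m (fun k w => \1_(H k) w * (\1_(Z k) w - p))).
- move=> k; apply: measurable_funM; first exact: measurable_indic.
  by apply: measurable_funB => //; exact: measurable_indic.
- move=> k w; rewrite !indicE ler_norml.
  by case: (w \in H k); case: (w \in Z k) => /=; lra.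
move=> j k jk.
have b (A : set T) : measurable A -> bounded_rv (\1_A : T -> R).
  exact: bounded_rv_indic.
have bZ (A : set T) (c : R) : measurable A -> bounded_rv (fun w : T => c * \1_A w).
  move=> mA; apply: (@bounded_rvM _ _ _ (cst c) (\1_A)); [exact: bounded_rv_cst|exact: b].
have fM A B : measurable A -> measurable B ->
    P B = (P A * p%:E)%E -> fine (P B) = fine (P A) * p.
  by move=> mA mB ->; rewrite fineM // fin_num_measure.
rewrite (_ : (fun _ => _) = fun w =>
    (\1_(H j `&` Z j `&` H k `&` Z k) w + (- p) * \1_(H j `&` Z j `&` H k) w)
    + ((- p) * \1_(H j `&` H k `&` Z k) w + p ^+ 2 * \1_(H j `&` H k) w)); last first.
  apply/funext => w; rewrite !indicE !in_setI.
  by case: (w \in H j); case: (w \in H k); case: (w \in Z j); case: (w \in Z k) => /=; ring.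
do ![rewrite meanD; [|try by [apply: b; do !apply: measurableI|
  apply: bZ; do !apply: measurableI|apply: bounded_rvD; [apply: b || apply: bZ|apply: bZ];
    do !apply: measurableI]..]].
rewrite !meanZ ?mean_indic; try by [apply: b; do !apply: measurableI|do !apply: measurableI].
rewrite (fM _ _ _ _ (I1 j k jk)); try by do !apply: measurableI.
rewrite (fM _ _ _ _ (I2 j k jk)); try by do !apply: measurableI.
ring.
Qed.

End events_lln.

(** * Thinning of an integer-valued measure *)

(** Monotonicity through the supremum over simple functions. It applies to the integrand of the
    Hawkes equation without a study of the measurability in time of the intensity. *)
Lemma ge0_le_integralT (d : measure_display) (T : measurableType d) (R : realType)
    (mu : {measure set T -> \bar R}) (f g : T -> \bar R) :
  (forall x, 0 <= f x)%E -> (forall x, f x <= g x)%E ->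
  (\int[mu]_x f x <= \int[mu]_x g x)%E.
Proof.
move=> f0 fg; have g0 x : (0 <= g x)%E by exact: le_trans (f0 x) (fg x).
rewrite !ge0_integralTE //; apply: ereal_sup_le => _ [h hf <-].
by exists h => // x; exact: le_trans (hf x) (fg x).
Qed.

(** * Atoms of integer-valued measures *)

Section integer_valued.
Variables (R : realType) (mu : {measure set R -> \bar R}).
Hypothesis intmu : forall B : set R, measurable B ->
  mu B = +oo%E \/ exists k : nat, mu B = k%:R%:E.

Lemma integer_ge1 (B : set R) : measurable B -> mu B != 0%E -> (1%:E <= mu B)%E.
Proof.
move=> mB; case: (intmu mB) => [->|[[|k] ->]]; rewrite ?leey ?eqxx // => _.
by rewrite lee_fin ler1n.
Qed.

(** Nonzero values are at least 1, and continuity from above would carry this bound to the limit. *)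
Lemma null_bigcap (F : nat -> set R) : (mu (F 0%N) < +oo)%E ->
  (forall n, measurable (F n)) -> nonincreasing_seq F ->
  mu (\bigcap_n F n) = 0%E -> exists n, mu (F n) = 0%E.
Proof.
move=> F0fin mF niF cap0; apply: contrapT => /forallNP nF.
have F1 n : (1%:E <= mu (F n))%E.
  by apply: integer_ge1 => //; apply/eqP; exact: nF.
have mcap : measurable (\bigcap_n F n) by exact: bigcapT_measurable.
have := nonincreasing_cvg_mu F0fin mF mcap niF.
move=> /cvg_lim => /(_ (@ereal_hausdorff _)) lim.
have : (1%:E <= mu (\bigcap_n F n))%E.
  rewrite -lim; apply: lime_ge; last by apply: nearW => n; exact: F1.
  by apply: ereal_nonincreasing_is_cvgn => n m nm; apply: le_measure;
    rewrite ?inE //; apply/subsetPset; exact: niF.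
by rewrite cap0 lee_fin ler10.
Qed.

Lemma null_subset (A B : set R) : measurable A -> measurable B -> A `<=` B ->
  mu B = 0%E -> mu A = 0%E.
Proof. by move=> mA mB AB; apply: subset_measure0. Qed.

(** The atom found is the first one, the supremum [s] of the [x] for which []a, x]] is null: the
    mass must appear exactly at [s]. *)
Lemma exists_atom (a b : R) : a < b -> (mu `]a, b]%classic < +oo)%E ->
  mu `]a, b]%classic != 0%E ->
  exists2 u, a < u <= b & mu [set u] != 0%E.
Proof.
move=> ab fin n0.
pose D := [set x | a <= x <= b /\ mu `]a, x]%classic = 0%E].
have Da : D a.
  split; first by rewrite lexx ltW.
  by rewrite set_itvoc0 measure0.
have supD : has_sup D.
  by split; [exists a | exists b => x [/andP[]]].
pose s := sup D.
have as_ : a <= s by apply: ub_le_sup => //; case: supD.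
have sb : s <= b by apply: ge_sup; [exists a|move=> x [/andP[]]].
have left0 : mu `]a, s[%classic = 0%E.
  apply/eqP; rewrite -measure_le0.
  have sub : `]a, s[%classic `<=` \bigcup_n `]a, s - n.+1%:R^-1]%classic.
    move=> x /=; rewrite in_itv /= => /andP[ax xs].
    have [n xn] := ltr_add_invr xs; exists n => //=.
    by rewrite in_itv /= ax lerBrDr ltW.
  have null n : mu `]a, s - n.+1%:R^-1]%classic = 0%E.
    have [x [/andP[ax xb] x0] xs] : exists2 x, D x & s - n.+1%:R^-1 < x.
      by apply: sup_adherent => //; rewrite invr_gt0.
    apply: null_subset x0 => // y /=; rewrite !in_itv /= => /andP[-> ys].
    by rewrite (le_trans ys) // ltW.
  have := @measure_sigma_subadditive _ _ _ mu `]a, s[%classic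
    (fun n => `]a, s - n.+1%:R^-1]%classic) (fun n => measurable_itv _)
    (measurable_itv _) sub.
  by rewrite eseries0.
(* Otherwise [null_bigcap] makes an interval reaching slightly beyond [s] null, against the
   definition of [s]. *)
have right1 : mu `]a, s]%classic != 0%E.
  have [sb'|bs] := ltP s b; last first.
    by have -> : s = b by apply/eqP; rewrite eq_le sb.
  pose F n := `]a, Num.min b (s + n.+1%:R^-1)]%classic.
  have mF n : measurable (F n) by exact: measurable_itv.
  have niF : nonincreasing_seq F.
    move=> n m nm; apply/subsetPset => x; rewrite /F /= !in_itv /= => /andP[-> /=].
    rewrite !le_min => /andP[-> /le_trans] /=; apply.
    by rewrite lerD2l lef_pV2 ?posrE // ler_nat.
  have capF : \bigcap_n F n = `]a, s]%classic.
    apply/seteqP; split => x.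
      move=> Fx; have := Fx 0%N I; rewrite /F /= !in_itv /= => /andP[-> _] /=.
      rewrite leNgt; apply/negP => /ltr_add_invr[n sx]; have := Fx n I.
      by rewrite /F /= in_itv /= le_min [x <= s + _]leNgt sx !andbF.
    rewrite /= in_itv /= => /andP[ax xs] n _; rewrite /F /= in_itv /= ax le_min.
    rewrite (le_trans xs sb) (le_trans xs) // lerDl; exact: ltW.
  have F0fin : (mu (F 0%N) < +oo)%E.
    apply: le_lt_trans fin; apply: le_measure; rewrite ?inE // => x.
    by rewrite /F /= !in_itv /= le_min => /andP[-> /andP[->]].
  apply/negP => /eqP; rewrite -capF => /(null_bigcap F0fin mF niF)[n F0].
  have lt : s < Num.min b (s + n.+1%:R^-1) by rewrite lt_min sb' ltrDl /=.
  have : D (Num.min b (s + n.+1%:R^-1)).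
    by split => //; rewrite (le_trans as_ (ltW lt)) ge_min lexx.
  by move/(ub_le_sup (proj2 supD)); rewrite leNgt lt.
have ltas : a < s.
  rewrite lt_neqAle as_ andbT; apply: contraNneq right1 => <-.
  by rewrite set_itvoc0 measure0.
exists s; first by rewrite ltas.
apply: contraNneq right1 => s0.
rewrite (_ : `]a, s]%classic = `]a, s[%classic `|` [set s]).
  by rewrite measureU0 // left0.
by rewrite setUitv1.
Qed.

End integer_valued.

(** * The Hawkes equation as a thinning of the strip *)

Section strip.
Variables (R : realType) (q : {measure set (R * R)%type -> \bar R}) (lambda : R).

Definition strip (B : set R) : \bar R := q (B `*` `]0, lambda]%classic).

Let strip0 : strip set0 = 0%E.
Proof. by rewrite /strip set0X measure0. Qed.

Let strip_ge0 B : (0 <= strip B)%E.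
Proof. exact: measure_ge0. Qed.

Let strip_sigma_additive : semi_sigma_additive strip.
Proof.
move=> F mF tF mUF; rewrite /strip.
rewrite (_ : (\bigcup_n F n) `*` _ = \bigcup_n (F n `*` `]0, lambda]%classic)).
  apply: measure_semi_sigma_additive.
  - by move=> n; apply: measurableX.
  - apply/trivIsetP => i j _ _ ij; rewrite -subset0 => -[x y] [[/= Fi _] [Fj _]].
    by move/trivIsetP: tF => /(_ i j I I ij); rewrite -subset0 => /(_ x); apply.
  - by apply: bigcupT_measurable => n; apply: measurableX.
apply/seteqP; split=> [[x y] [[n _ Fn] yl]|[x y] [n _ [Fn yl]]]; first by exists n.
by split => //; exists n.
Qed.

HB.instance Definition _ := isMeasure.Build _ _ _ strip
  strip0 strip_ge0 strip_sigma_additive.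

End strip.

Section thinning.
Variables (R : realType) (q : {measure set (R * R)%type -> \bar R})
  (nu : {measure set R -> \bar R}) (lambda r A : R).
Hypothesis lambda0 : 0 < lambda.
Hypothesis intnu : forall B : set R, measurable B ->
  nu B = +oo%E \/ exists k : nat, nu B = k%:R%:E.
Let h (x : R) := - lambda * \1_(`[r, r + A]) x.
Hypothesis nuE : forall B : set R, measurable B ->
  nu B = (\int[q]_(x in @positive R `*` @positive R)
      (\d_(x.1) B *
       (\1_[set y : R * R | (y.2%:E <= hawkes_intensity lambda h nu y.1)%E]
          x)%:E))%E.

(** The condition [s < u] matters only for [r = 0], where it excludes [u] itself. *)
Definition window (u : R) : set R :=
  [set s | s < u] `&` `[u - (r + A), u - r]%classic.

Lemma measurable_window u : measurable (window u).
Proof.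
apply: measurableI => //.
by rewrite (_ : [set s | s < u] = `]-oo, u[%classic) // set_itvE.
Qed.

(** Each point of the window subtracts exactly lambda, so a single one brings the positive part to
    0. *)
Lemma hawkes_intensityE u : hawkes_intensity lambda h nu u =
  if nu (window u) == 0%E then lambda%:E else 0%E.
Proof.
rewrite /hawkes_intensity.
have mlt : measurable [set s : R | s < u].
  by rewrite (_ : [set s | s < u] = `]-oo, u[%classic) // set_itvE.
have -> : (\int[nu]_(s in [set s : R | (s < u)%R]) (h (u - s))%:E =
    - (lambda%:E * nu (window u)))%E.
  rewrite (eq_integral (fun s => - (lambda%:E * (\1_(`[u - (r + A), u - r]%classic) s)%:E))%E).
    rewrite integral_ge0N; last by move=> s _; rewrite mule_ge0 // lee_fin ?(ltW lambda0).
    rewrite ge0_integralZl_EFin ?(ltW lambda0) //; last first.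
    - by apply/measurable_EFinP; apply: measurable_indic.
    rewrite integral_indic //; congr (- (_ * nu _))%E.
    by rewrite /window setIC.
  move=> s _; rewrite /h -EFinM -EFinN mulNr; congr (- (_ * _))%:E.
  rewrite !indicE; congr (_%:R); congr (nat_of_bool _).
  apply/idP/idP; rewrite !inE /= !in_itv /= => /andP[a b]; apply/andP; split; lra.
case: (intnu (measurable_window u)) => [->|[k ->]].
  rewrite gt0_muley ?lte_fin //= addeNy /maxe /=.
  by rewrite ltNye.
rewrite -EFinM -EFinN -EFinD; case: k => [|k].
  rewrite mulr0 subr0 eqxx; apply/max_idPl.
  by rewrite lee_fin ltW.
rewrite eqe pnatr_eq0 /=; apply/max_idPr.
rewrite lee_fin subr_le0 ler_peMr ?ler1n //; exact: ltW.
Qed.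

Let f (B : set R) (x : R * R) : \bar R := ((\d_(x.1) B *
       (\1_[set y : R * R | (y.2%:E <= hawkes_intensity lambda h nu y.1)%E]
          x)%:E))%E.

Lemma thinning_le (B : set R) : measurable B -> B `<=` @positive R ->
  (nu B <= strip q lambda B)%E.
Proof.
move=> mB Bpos; rewrite nuE // integral_mkcond.
have -> : strip q lambda B =
    (\int[q]_x (\1_(B `*` `]0, lambda]%classic) x)%:E)%E.
  by rewrite integral_indic ?setIT //; exact: measurableX.
apply: ge0_le_integralT => x; rewrite patchE.
  by case: ifP => // _; rewrite mule_ge0 ?lee_fin // measure_ge0.
case: ifP => xpos; last by rewrite lee_fin.
rewrite diracE !indicE; have [xB|_] := boolP (x.1 \in B); last first.
  by rewrite mul0e lee_fin.
rewrite mul1e lee_fin ler_nat.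
case: (boolP (x \in [set y : R * R | _])) => [|_]; last by [].
rewrite inE /= hawkes_intensityE => xl.
rewrite (_ : x \in _ = true) //; apply/mem_set; split => /=.
  by move: xB; rewrite inE.
move: xpos; rewrite inE => -[_ x2]; rewrite in_itv /= x2 /=.
by move: xl; case: ifP => _; rewrite lee_fin // => /le_lt_trans => /(_ _ (x2 : 0 < x.2));
  rewrite ltxx.
Qed.

(** At a fixed time the acceptance region is either the whole column of height lambda or disjoint
    from the quadrant. Together with the existence of atoms, this rule at singletons determines the
    dynamics. *)
Lemma thinning_point u : 0 < u ->
  nu [set u] = if nu (window u) == 0%E then strip q lambda [set u] else 0%E.
Proof.
move=> u0; rewrite nuE // integral_mkcond.
have [w0|w0] := boolP (nu (window u) == 0%E).
  rewrite (_ : strip _ _ _ = (\int[q]_x (\1_([set u] `*` `]0, lambda]%classic) x)%:E)%E).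
    apply: eq_integral => x _; rewrite patchE diracE !indicE.
    have [xu|xu] := eqVneq x.1 u; last first.
      rewrite [x.1 \in _](_ : _ = false) ?mul0e; last first.
        by apply/negbTE; rewrite notin_setE /=; exact/eqP.
      rewrite if_same [x \in _](_ : _ = false) //.
      by apply/negbTE; rewrite notin_setE => -[/= /eqP]; rewrite (negbTE xu).
    rewrite xu [u \in _](_ : _ = true) ?mul1e; last exact: mem_set.
    case: ifPn => [|xpos].
      rewrite inE => -[_ x2]; congr (_%:R)%:E; congr (nat_of_bool _).
      apply/idP/idP; rewrite !inE /= hawkes_intensityE xu w0 lee_fin in_itv /=.
        by move=> ->; split=> //; rewrite andbT.
      by move=> [_ /andP[]].
    rewrite [x \in _](_ : _ = false) //; apply/negbTE; move: xpos; rewrite !notin_setE.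
    move=> nx [xE]; rewrite /= in_itv /= => /andP[x20 _]; apply: nx.
    by split => //=; rewrite /positive /= xE.
  by rewrite integral_indic ?setIT //; exact: measurableX.
rewrite -[RHS](integral0 q setT); apply: eq_integral => x _.
rewrite patchE; case: ifPn => // ; rewrite inE => -[x1 x2].
rewrite diracE !indicE; have [xu|xu] := eqVneq x.1 u; last first.
  rewrite [x.1 \in _](_ : _ = false) ?mul0e //.
  by apply/negbTE; rewrite notin_setE /=; exact/eqP.
rewrite [x \in _](_ : _ = false) ?mule0 //; apply/negbTE.
rewrite notin_setE /= hawkes_intensityE xu (negbTE w0) lee_fin => h2.
by move: (lt_le_trans (x2 : 0 < x.2) h2); rewrite ltxx.
Qed.

End thinning.

(* [pi] is meant to be the strip process of [Q w] and [nu] to be [N w]. *)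
Record thinned (R : realType) (r A : R) (pi nu : {measure set R -> \bar R})
    : Prop := Thinned {
  thinned_int_pi : forall B : set R, measurable B ->
    pi B = +oo%E \/ exists k : nat, pi B = k%:R%:E ;
  thinned_int : forall B : set R, measurable B ->
    nu B = +oo%E \/ exists k : nat, nu B = k%:R%:E ;
  thinned_supp : nu (~` @positive R) = 0%E ;
  thinned_le : forall B : set R, measurable B -> B `<=` @positive R ->
    (nu B <= pi B)%E ;
  thinned_fin : forall n : nat, (pi `]0%R, n%:R%R]%classic < +oo)%E ;
  thinned_point : forall u, 0 < u ->
    nu [set u] = if nu (window r A u) == 0%E then pi [set u] else 0%E }.

(** * Pathwise rules for the kept points *)

Section thinned_paths.
Variables (R : realType) (r A : R) (pi nu : {measure set R -> \bar R}).
Hypotheses (r0 : 0 <= r) (rA : r < A) (th : thinned r A pi nu).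

Let mwin u : measurable (window r A u) := measurable_window r A u.

Lemma measurable_positive : measurable (@positive R).
Proof. by rewrite (_ : @positive R = `]0, +oo[%classic) // set_itvE. Qed.

Lemma itv_positive (a b : R) : 0 <= a -> `]a, b]%classic `<=` @positive R.
Proof. by move=> a0 x /=; rewrite in_itv /positive /= => /andP[+ _]; exact: le_lt_trans. Qed.

Lemma pi_itv_fin (a b : R) : 0 <= a -> (pi `]a, b]%classic < +oo)%E.
Proof.
move=> a0; apply: le_lt_trans (thinned_fin th (Num.truncn b).+1).
apply: le_measure; rewrite ?inE // => x /=; rewrite !in_itv /= => /andP[ax xb].
by rewrite (le_lt_trans a0 ax) (le_trans xb) // ltW // truncnS_gt.
Qed.

Lemma nu_itv_fin (a b : R) : 0 <= a -> (nu `]a, b]%classic < +oo)%E.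
Proof.
move=> a0; apply: le_lt_trans (pi_itv_fin b a0).
by apply: (thinned_le th) => //; exact: itv_positive.
Qed.

Lemma ltoc_nonempty (mu : {measure set R -> \bar R}) (a b : R) :
  mu `]a, b]%classic != 0%E -> a < b.
Proof.
move=> h; rewrite ltNge; apply: contraNN h => ba.
by rewrite set_itv_ge ?measure0 // bnd_simp -leNgt.
Qed.

Lemma pi_atom (a b : R) : 0 <= a -> pi `]a, b]%classic != 0%E ->
  exists2 u, a < u <= b & pi [set u] != 0%E.
Proof.
move=> a0 n0; apply: exists_atom => //; first exact: thinned_int_pi th.
  exact: ltoc_nonempty n0.
exact: pi_itv_fin.
Qed.

Lemma nu_atom (a b : R) : 0 <= a -> nu `]a, b]%classic != 0%E ->
  exists u, [/\ a < u <= b, nu [set u] != 0%E, nu (window r A u) = 0%E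
             & pi [set u] != 0%E].
Proof.
move=> a0 n0; have [u aub u1] : exists2 u, a < u <= b & nu [set u] != 0%E.
  apply: exists_atom => //; first exact: thinned_int th.
    exact: ltoc_nonempty n0.
  exact: nu_itv_fin.
exists u; split => //; move: u1; rewrite (thinned_point th) ?(le_lt_trans a0);
  try by case/andP: aub.
  by case: ifP => [/eqP|]; rewrite ?eqxx.
by case: ifP; rewrite ?eqxx.
Qed.

Lemma accept u : 0 < u -> nu (window r A u) = 0%E -> pi [set u] != 0%E ->
  nu [set u] != 0%E.
Proof. by move=> u0 w0; rewrite (thinned_point th) // w0 eqxx. Qed.

Lemma nu_neq0_sub (B C : set R) : measurable B -> measurable C -> B `<=` C ->
  nu B != 0%E -> nu C != 0%E.
Proof.
move=> mB mC BC; apply: contraNneq => C0; apply/eqP.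
exact: null_subset BC C0.
Qed.

Lemma null_cover (B : set R) (F : nat -> set R) : measurable B ->
  (forall n, measurable (F n)) -> (forall n, nu (F n) = 0%E) ->
  B `&` @positive R `<=` \bigcup_n F n -> nu B = 0%E.
Proof.
move=> mB mF F0 BF; apply/eqP; rewrite -measure_le0.
pose G n := if n is n'.+1 then F n' else ~` @positive R.
have mG n : measurable (G n).
  by case: n => [|n] //=; apply: measurableC; exact: measurable_positive.
have sub : B `<=` \bigcup_n G n.
  move=> x Bx; have [xpos|xneg] := pselect (positive x); last by exists 0%N.
  by have [n _ Fn] := BF x (conj Bx xpos); exists n.+1.
have := @measure_sigma_subadditive _ _ _ nu B G mG mB sub.
by rewrite eseries0 // => -[|n] _ _ /=; [exact: thinned_supp th|exact: F0].
Qed.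

Lemma null_coverU (B C D : set R) : measurable B -> measurable C -> measurable D ->
  nu C = 0%E -> nu D = 0%E -> B `&` @positive R `<=` C `|` D -> nu B = 0%E.
Proof.
move=> mB mC mD C0 D0 BCD.
apply: (@null_cover _ (fun n => if n is 0%N then C else D)) => //.
- by case.
- by case.
- by move=> x /BCD[Cx|Dx]; [exists 0%N|exists 1%N].
Qed.

Section grid.
Variables (delta : R) (L M : nat).
Hypotheses (delta0 : 0 < delta) (rE : r = L%:R * delta)
  (AM : M%:R * delta <= A) (MA : A < M.+1%:R * delta).

Definition cell (k : nat) : set R := `]k%:R * delta, k.+1%:R * delta]%classic.
Definition hit k := pi (cell k) != 0%E.
Definition event k := nu (cell k) != 0%E.

Lemma cell_ge0 k : 0 <= k%:R * delta.
Proof. by rewrite mulr_ge0 // ltW. Qed.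

Lemma cell_positive k : cell k `<=` @positive R.
Proof. exact/itv_positive/cell_ge0. Qed.

Lemma ltr_grid (i j : nat) : (i%:R * delta < j%:R * delta) = (i < j)%N.
Proof. by rewrite ltr_pM2r // ltr_nat. Qed.

Lemma ler_grid (i j : nat) : (i%:R * delta <= j%:R * delta) = (i <= j)%N.
Proof. by rewrite ler_pM2r // ler_nat. Qed.

Lemma cell_exists s : 0 < s -> exists j, cell j s.
Proof.
move=> s0; have exP : exists j, s <= j.+1%:R * delta.
  exists (Num.truncn (s / delta)); rewrite -ler_pdivrMr //.
  exact/ltW/truncnS_gt.
case: (ex_minnP exP) => j sj jmin; exists j; rewrite /cell /= in_itv /= sj andbT.
case: j sj jmin => [|j] sj jmin; first by rewrite mul0r.
by rewrite ltNge; apply/negP => /jmin; rewrite ltnn.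
Qed.

Lemma event_hit k : event k -> hit k.
Proof.
apply: contraNN => /eqP p0; rewrite -measure_le0 -p0; apply: (thinned_le th).
  exact: measurable_itv.
exact: cell_positive.
Qed.

Lemma event_block j k : (j + L < k)%N -> (k < j + L + M)%N ->
  event j -> ~~ event k.
Proof.
move=> jk kj /(nu_atom (cell_ge0 j))[v [/andP[jv vj] v0 _ _]].
apply/negP => /(nu_atom (cell_ge0 k))[u [/andP[ku uk] _ w0 _]].
move/eqP: v0; apply; apply: null_subset w0 => // _ ->; rewrite /window /= in_itv /=.
have h1 : j.+1%:R * delta + L%:R * delta <= k%:R * delta.
  by rewrite -mulrDl -natrD ler_grid; move: jk; clear; lia.
have h2 : k.+1%:R * delta <= j%:R * delta + L%:R * delta + M%:R * delta.
  by rewrite -!mulrDl -!natrD ler_grid; move: kj; clear; lia.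
have h3 : 0 <= L%:R * delta by exact: cell_ge0.
split; first by lra.
move: h1 h2 AM uk jv vj ku; set x1 := j.+1%:R * delta; set x2 := k.+1%:R * delta.
set x3 := L%:R * delta; set x4 := M%:R * delta; set x5 := j%:R * delta.
by move=> *; apply/andP; rewrite rE -/x3; split; lra.
Qed.

(** If cell [k] had no kept point, the window of a point of pi in it would be covered by empty
    cells, and that point would be kept. Arguing by contradiction also covers cell [k] itself, which
    the window can reach when [L = 0]. *)
Lemma event_accept k : hit k ->
  (forall j, j < k -> j + L <= k -> k <= j + L + M + 1 -> ~~ event j)%N -> event k.
Proof.
move=> /(pi_atom (cell_ge0 k))[u /andP[ku uk] pu] noj.
have [//|nek] := boolP (event k); exfalso.
have u0 : 0 < u by apply: le_lt_trans ku; exact: cell_ge0.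
have w0 : nu (window r A u) = 0%E.
  apply: (@null_cover _ (fun j => if event j then set0 else cell j)) => //.
  - by move=> n; case: ifP => // _; exact: measurable_itv.
  - by move=> n; case: ifPn => [_|/negPn/eqP//]; rewrite measure0.
  move=> s [[/= su]]; rewrite in_itv /= => /andP[su1 su2 s0].
  have [j cj] := cell_exists s0; exists j => //.
  move: (cj); rewrite /cell /= in_itv /= => /andP[js sj].
  have jLk : (j + L <= k)%N.
    rewrite -ltnS -ltr_grid natrD mulrDl; move: su2; rewrite rE; lra.
  have kjLM : (k <= j + L + M + 1)%N.
    rewrite -ltnS -ltr_grid; move: su1 MA; rewrite rE.
    rewrite (_ : (j + L + M + 1).+1 = j.+1 + L + M.+1)%N; last by clear; lia.
    by rewrite !natrD !mulrDl; lra.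
  have [jk|jk] := eqVneq j k; first by rewrite jk (negbTE nek) -jk.
  have jlt : (j < k)%N by move: jk jLk; clear; lia.
  by rewrite (negbTE (noj j jlt jLk kjLM)).
move/negPn/eqP: nek => nek; move/eqP: (accept u0 w0 pu); apply.
apply: null_subset nek; [exact: measurable_set1|exact: measurable_itv|].
by move=> _ ->; rewrite /cell /= in_itv /= ku.
Qed.

End grid.

(* Rational end points make this a countable union of elementary events; the
   meaning is given by [acceptableP]. *)
Definition acceptable (t a b : R) := exists x y : rat,
  pi (`]ratr x, ratr y]%classic `&` `]a, b]%classic) != 0%E /\
  nu (`]ratr x - (r + A), ratr y - r]%classic `&` `]0, t]%classic) = 0%E.

Lemma itv_oc_setI (a b c e : R) : `]a, b]%classic `&` `]c, e]%classic =
  `]Num.max a c, Num.min b e]%classic.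
Proof.
apply/seteqP; split => x /=; rewrite !in_itv /= gt_max le_min.
  by move=> [/andP[-> ->] /andP[-> ->]].
by move=> /andP[/andP[-> ->] /andP[-> ->]].
Qed.

(** For the converse, slightly enlarged windows decrease to the window of [u], so by integrality one
    of them is already null; this leaves room for rationals on both sides of [u]. *)
Lemma acceptableP (t a b : R) : 0 <= t -> t <= a ->
  acceptable t a b <-> exists u, [/\ a < u <= b, pi [set u] != 0%E &
    nu (window r A u `&` `]0, t]%classic) = 0%E].
Proof.
move=> t0 ta; have a0 : 0 <= a by exact: le_trans ta.
split=> [[x [y [px nx]]]|[u [/andP[au ub] pu nw]]].
  move: px; rewrite itv_oc_setI => /pi_atom[|u /andP[xu uy] pu].
    by rewrite le_max a0 orbT.
  move: xu uy; rewrite gt_max le_min => /andP[xu au] /andP[uy ub].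
  exists u; split; rewrite ?au //; apply: null_subset nx.
  - exact: measurableI.
  - exact: measurableI.
  - move=> s [[/= su]]; rewrite in_itv /= => /andP[s1 s2] s3; split => //=.
    by rewrite in_itv /=; apply/andP; split; lra.
pose F n := `]u - n.+1%:R^-1 - (r + A), u + n.+1%:R^-1 - r]%classic `&` `]0, t]%classic.
have mF n : measurable (F n) by exact: measurableI.
have capF : \bigcap_n F n = window r A u `&` `]0, t]%classic.
  apply/seteqP; split => s.
    move=> Fs; have [_ st] := Fs 0%N I; split => //.
    have st' : s <= t by move: st; rewrite /= in_itv /= => /andP[].
    split => /=; first by lra.
    rewrite in_itv /=; apply/andP; split; rewrite leNgt; apply/negP => lt.
      have [n nlt] := ltr_add_invr lt.
      have [+ _] := Fs n I; rewrite /= in_itv /= => /andP[+ _].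
      by move: nlt; set z := n.+1%:R^-1; lra.
    have [n nlt] := ltr_add_invr lt.
    have [+ _] := Fs n I; rewrite /= in_itv /= => /andP[_].
    by move: nlt; set z := n.+1%:R^-1; lra.
  move=> [[/= su]]; rewrite in_itv /= => /andP[s1 s2] st n _; split => //=.
  have : 0 < n.+1%:R^-1 :> R by [].
  by rewrite in_itv /=; set z := n.+1%:R^-1 => z0; apply/andP; split; lra.
have niF : nonincreasing_seq F.
  move=> n m nm; apply/subsetPset => s [] /=; rewrite in_itv /= => /andP[s1 s2] st.
  have le : m.+1%:R^-1 <= n.+1%:R^-1 :> R by rewrite lef_pV2 ?posrE // ler_nat.
  split => //=; rewrite in_itv /=; move: le s1 s2.
  set z := n.+1%:R^-1; set z' := m.+1%:R^-1; lra.
have F0fin : (nu (F 0%N) < +oo)%E.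
  apply: le_lt_trans (nu_itv_fin t (lexx 0)).
  by apply: le_measure; rewrite ?inE // => s [].
have [n Fn] : exists n, nu (F n) = 0%E.
  by apply: null_bigcap => //; [exact: thinned_int th|rewrite capF].
have z0 : 0 < n.+1%:R^-1 :> R by [].
have lt1 : u - n.+1%:R^-1 < u by rewrite ltrBlDr ltrDl.
have lt2 : u < u + n.+1%:R^-1 by rewrite ltrDl.
have [x xu] := rat_in_itvoo lt1.
have [y yu] := rat_in_itvoo lt2.
move: xu yu; rewrite !in_itv /= => /andP[x1 x2] /andP[y1 y2].
exists x, y; split.
  apply: contra_neq pu => p0; apply: null_subset p0 => //; first exact: measurableI.
  by move=> _ ->; split => /=; rewrite in_itv /= ?au ?ub // x2 ltW.
apply: null_subset Fn => //; first exact: measurableI.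
move=> s [/=]; rewrite in_itv /= => /andP[s1 s2] st; split => //=.
rewrite in_itv /=; move: x1 y2; set z := n.+1%:R^-1 => x1 y2.
by apply/andP; split; lra.
Qed.

(** Up to time [t + r], windows look back no later than [t], so acceptance is decided by pi and by
    the kept points up to [t]. *)
Lemma event_lag (t a b : R) : 0 <= t -> t <= a -> b <= t + r ->
  nu `]a, b]%classic != 0%E <-> acceptable t a b.
Proof.
move=> t0 ta bt; have a0 : 0 <= a by exact: le_trans ta.
rewrite (acceptableP _ t0 ta); split.
  move=> /(nu_atom a0)[u [aub _ w0 pu]]; exists u; split => //.
  by apply: null_subset w0 => //; exact: measurableI.
move=> [u [/andP[au ub] pu nw]].
have u0 : 0 < u by exact: le_lt_trans au.
apply: (nu_neq0_sub _ _ _ (accept u0 _ pu)) => //.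
  by move=> _ ->; rewrite /= in_itv /= au.
apply: (null_coverU (C := window r A u `&` `]0, t]%classic) (D := set0)) => //.
- exact: measurableI.
- by move=> s [[/= su sw] s0]; left; split => //=; move: sw; rewrite !in_itv /= s0; lra.
Qed.

(** A point acceptable at time [t] can be refused only because of another kept point after [t], and
    then []t, b]] is charged anyway. *)
Lemma first_event (t b : R) : 0 <= t ->
  nu `]t, b]%classic != 0%E <-> acceptable t t b.
Proof.
move=> t0; rewrite (acceptableP _ t0 (lexx t)); split.
  move=> /(nu_atom t0)[u [aub _ w0 pu]]; exists u; split => //.
  by apply: null_subset w0 => //; exact: measurableI.
move=> [u [/andP[au ub] pu nw]]; apply/negP => /eqP tb0.
have u0 : 0 < u by exact: le_lt_trans au.
have w0 : nu (window r A u) = 0%E.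
  apply: (null_coverU (C := window r A u `&` `]0, t]%classic) (D := `]t, b]%classic)) => //.
    exact: measurableI.
  move=> s [[/= su sw] s0]; have [st|st] := leP s t.
    by left; split => //=; rewrite in_itv /= s0.
  by right; rewrite /= in_itv /= st; lra.
move/eqP: (accept u0 w0 pu); apply.
by apply: null_subset tb0 => // _ ->; rewrite /= in_itv /= au.
Qed.

(** Without lag, a kept point in []t, a]] inhibits the rest of []t, t + A]], so the question reduces
    to intervals starting at [t], which [first_event] settles. *)
Lemma event_nolag (t a b : R) : r = 0 -> 0 <= t -> t <= a -> b <= t + A ->
  nu `]a, b]%classic != 0%E <->
  nu `]t, a]%classic = 0%E /\ nu `]t, b]%classic != 0%E.
Proof.
move=> rz t0 ta bt; have a0 : 0 <= a by exact: le_trans ta.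
split.
  move=> h; have [u [/andP[au ub] _ w0 _]] := nu_atom a0 h; split.
    apply: null_subset w0 => // s; rewrite /window /= !in_itv /= => /andP[ts sa].
    by split; [|apply/andP; split]; lra.
  apply: nu_neq0_sub h => // s /=; rewrite !in_itv /= => /andP[as_ ->].
  by rewrite andbT; lra.
move=> [ta0 /eqP tb0]; apply/negP => /eqP ab0; apply: tb0.
apply: (null_coverU (C := `]t, a]%classic) (D := `]a, b]%classic)) => //.
move=> s [/= + _]; rewrite !in_itv /= => /andP[ts sb].
by have [sa|sa] := leP s a; [left|right]; rewrite ?ts ?sb.
Qed.

End thinned_paths.

(** * Adaptedness *)

Section sigma_algebra_closure.
Variables (T : Type) (S : set (set T)).
Hypothesis sS : sigma_algebra setT S.

Lemma salg_setC X : S X -> S (~` X).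
Proof. by case: sS => _ C _ /C; rewrite setTD. Qed.

Lemma salg_set0 : S set0. Proof. by case: sS. Qed.

Lemma salg_setT : S setT.
Proof. by rewrite -setC0; exact/salg_setC/salg_set0. Qed.

Lemma salg_bigcup (I : countType) (X : I -> set T) :
  (forall i, S (X i)) -> S (\bigcup_i X i).
Proof.
move=> SX; case: sS => _ _ U.
rewrite (_ : \bigcup_i X i =
    \bigcup_n (if @unpickle I n is Some i then X i else set0)).
  by apply: U => n; case: unpickle => // ; exact: salg_set0.
apply/seteqP; split => w; last first.
  by move=> [n _]; case: unpickle => // i Xi; exists i.
by move=> [i _ Xi]; exists (pickle i) => //; rewrite pickleK.
Qed.

Lemma salg_setU X Y : S X -> S Y -> S (X `|` Y).
Proof.
move=> SX SY; rewrite (_ : X `|` Y = \bigcup_(b : bool) (if b then X else Y)).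
  by apply: salg_bigcup => -[].
apply/seteqP; split => w; first by move=> [?|?]; [exists true|exists false].
by move=> [[] _ ?]; [left|right].
Qed.

Lemma salg_setI X Y : S X -> S Y -> S (X `&` Y).
Proof.
by move=> SX SY; rewrite -[_ `&` _]setCK setCI; apply/salg_setC/salg_setU;
  exact: salg_setC.
Qed.

End sigma_algebra_closure.

Section adapted.
Context (R : realType) (d : measure_display) (T : measurableType d)
  (P : probability T R) (F : R -> set (set T))
  (Q : T -> {measure set (R * R)%type -> \bar R})
  (N : T -> {measure set R -> \bar R}) (lambda r A : R).
Hypotheses (hF : usual_conditions P F) (hQ : filtered_poisson P F Q)
  (r0 : 0 <= r) (rA : r < A).

Let path w : Prop := thinned r A (strip (Q w) lambda) (N w).
Hypothesis path_ae : {ae P, forall w, path w}.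

Lemma strip_event_in (a b : R) (D : set (R * R)) :
  `]a, b]%classic `*` `]0, lambda]%classic `<=` D ->
  events_in Q D [set w | strip (Q w) lambda `]a, b]%classic = 0%E].
Proof.
move=> sub; apply: sub_sigma_algebra.
exists (`]a, b]%classic `*` `]0, lambda]%classic), [set 0%E]; split => //.
exact: measurableX.
Qed.

Lemma strip_adapted (a b : R) : 0 <= a -> 0 <= b ->
  F b [set w | strip (Q w) lambda `]a, b]%classic = 0%E].
Proof.
move=> a0 b0; apply: (fp_adapted hQ b0); apply: strip_event_in.
move=> [x y] [/=]; rewrite !in_itv /= => /andP[ax xb] /andP[y0 _].
by split => //=; rewrite ?in_itv /= xb (le_lt_trans a0 ax).
Qed.

(** The thinning rules hold only almost surely; completeness of the filtration absorbs the
    exceptional set. *)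
Lemma ae_event (t : R) (X Y : set T) : 0 <= t -> F t Y ->
  (forall w, path w -> X w <-> Y w) -> F t X.
Proof.
move=> t0 FY XY; have sF := filt_sigma_algebra hF t0.
have null (Z : set T) : Z `<=` ~` path -> F t Z.
  move=> Zb; apply: (filt_mono hF (lexx 0) t0); apply: (filt_complete hF).
  exact: negligibleS Zb path_ae.
have Fp : F t path by rewrite -[path]setCK; apply: salg_setC => //; exact: null.
rewrite (_ : X = (Y `&` path) `|` (X `&` ~` path)).
  apply: salg_setU => //; last by apply: null => w [].
  exact: salg_setI.
apply/seteqP; split => w.
  by move=> Xw; have [pw|pw] := pselect (path w); [left; split => //; exact/XY|right].
by case=> [[Yw pw]|[]//]; exact/XY.
Qed.

Definition adapted_at (t : R) := forall a b : R, 0 <= a -> b <= t ->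
  F t [set w | N w `]a, b]%classic = 0%E].

Lemma salg_neq0 (t : R) (f : T -> \bar R) : 0 <= t ->
  F t [set w | f w = 0%E] -> F t [set w | f w != 0%E].
Proof.
move=> t0 h; rewrite (_ : [set _ | _ != _] = ~` [set w | f w = 0%E]).
  by apply: salg_setC => //; exact: (filt_sigma_algebra hF t0).
by apply/seteqP; split => w /=; move/eqP.
Qed.

Lemma acceptable_adapted (t a b : R) : 0 <= t -> t <= a -> t <= b ->
  adapted_at t ->
  F b [set w | acceptable r A (strip (Q w) lambda) (N w) t a b].
Proof.
move=> t0 ta tb adt; have b0 : 0 <= b by exact: le_trans tb.
have sF := filt_sigma_algebra hF b0.
rewrite (_ : [set _ | _] = \bigcup_(x : rat) \bigcup_(y : rat)
  ([set w | strip (Q w) lambda `]Num.max (ratr x) a, Num.min (ratr y) b]%classic != 0%E] `&`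
   [set w | N w `]Num.max (ratr x - (r + A)) 0, Num.min (ratr y - r) t]%classic = 0%E])).
  do 2![apply: salg_bigcup => // ?]; apply: salg_setI => //.
    apply: salg_neq0 => //; set a' := Num.max _ _; set b' := Num.min _ _.
    (* A rational end point may be negative, outside the time range of the filtration; the interval
       is then empty. *)
    have [b'0|b'0] := leP 0 b'.
      apply: (filt_mono hF b'0); first by rewrite /b' ge_min lexx orbT.
      by apply: strip_adapted => //; rewrite /a' le_max (le_trans t0 ta) orbT.
    rewrite (_ : [set _ | _] = setT); first exact: salg_setT.
    apply/seteqP; split => // w _ /=; rewrite set_itv_ge ?measure0 // bnd_simp -leNgt.
    by rewrite ltW // (lt_le_trans b'0) // /a' le_max (le_trans t0 ta) orbT.
  apply: (filt_mono hF t0 tb); apply: adt; first by rewrite le_max lexx orbT.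
  by rewrite ge_min lexx orbT.
apply/seteqP; split => w.
  move=> [x [y []]]; rewrite !itv_oc_setI => px nx.
  by exists x => //; exists y.
by move=> [x _ [y _ [px nx]]]; exists x, y; rewrite !itv_oc_setI.
Qed.

Lemma adapted_after (t t' a b : R) : 0 <= t -> t <= a -> a <= b -> t <= b -> b <= t' ->
  t' <= t + (if r == 0 then A else r) -> adapted_at t ->
  F t' [set w | N w `]a, b]%classic = 0%E].
Proof.
move=> t0 ta ab tb bt' t's adt; have b0 : 0 <= b by exact: le_trans tb.
have a0 : 0 <= a by exact: le_trans ta.
have sF := filt_sigma_algebra hF b0.
apply: (filt_mono hF b0 bt').
rewrite (_ : [set _ | _] = ~` [set w | N w `]a, b]%classic != 0%E]); last first.
  by apply/seteqP; split => w /=; [move=> ->; rewrite eqxx|move/negP/negPn/eqP].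
apply: salg_setC => //.
move: t's; case: eqVneq => [rz|rnz] t's.
  apply: (@ae_event _ _ (~` [set w | acceptable r A (strip (Q w) lambda) (N w) t t a]
     `&` [set w | acceptable r A (strip (Q w) lambda) (N w) t t b])) => //.
    apply: salg_setI => //; last exact: acceptable_adapted.
    apply: salg_setC => //; apply: (filt_mono hF a0 ab).
    exact: acceptable_adapted.
  move=> w pw /=; rewrite (event_nolag pw rz t0 ta (le_trans bt' t's)).
  rewrite -(first_event pw b t0) -(first_event pw a t0).
  split=> -[h1 h2]; split => //; first by rewrite h1 eqxx.
  by move/negP/negPn/eqP: h1.
apply: (@ae_event _ _ [set w | acceptable r A (strip (Q w) lambda) (N w) t a b]) => //.
  exact: acceptable_adapted.
by move=> w pw /=; rewrite (event_lag pw t0 ta (le_trans bt' t's)).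
Qed.

Lemma adapted_step (t t' : R) : 0 <= t -> t <= t' ->
  t' <= t + (if r == 0 then A else r) -> adapted_at t -> adapted_at t'.
Proof.
move=> t0 tt' t's adt a b a0 bt'; have t'0 : 0 <= t' by exact: le_trans tt'.
have sF := filt_sigma_algebra hF t'0.
have [ba|ab] := leP b a.
  rewrite (_ : [set _ | _] = setT); first exact: salg_setT.
  apply/seteqP; split => // w _ /=.
  by rewrite set_itv_ge ?measure0 // bnd_simp -leNgt.
have [bt|tb] := leP b t; first by apply: (filt_mono hF t0 tt'); exact: adt.
have [ta|lat] := leP t a.
  exact: (adapted_after t0 ta (ltW ab) (ltW tb) bt' t's adt).
rewrite (_ : [set _ | _] = [set w | N w `]a, t]%classic = 0%E] `&`
    [set w | N w `]t, b]%classic = 0%E]).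
  apply: salg_setI => //; first by apply: (filt_mono hF t0 tt'); exact: adt.
  exact: (adapted_after t0 (lexx t) (ltW tb) (ltW tb) bt' t's adt).
apply/seteqP; split => w /=.
  move=> h; split; apply: null_subset h => // x /=; rewrite !in_itv /= => /andP[h1 h2].
    by rewrite h1 (le_trans h2) // ltW.
  by rewrite h2 (lt_trans lat).
move=> [h1 h2]; rewrite (_ : `]a, b]%classic = `]a, t]%classic `|` `]t, b]%classic).
  by rewrite measureU0.
apply/seteqP; split => x /=; rewrite !in_itv /=.
  by move=> /andP[h3 h4]; have [h5|h5] := leP x t; [left; rewrite h3|right].
move=> [] /andP[h3 h4]; rewrite ?h3 ?h4 ?andbT ?(lt_trans lat h3) //=.
by rewrite (le_trans h4) // ltW.
Qed.

(* Only the measurability of N is assumed. The intensity at u depends on N before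
   u - r, hence adaptedness propagates by steps of length r; if r = 0, at most
   one point is kept in an interval of length A and steps of length A do. *)
Theorem counts_adapted (a b : R) : 0 <= a -> 0 <= b ->
  F b [set w | N w `]a, b]%classic = 0%E].
Proof.
move=> a0 b0; suff all (n : nat) (t : R) : 0 <= t ->
    t <= n%:R * (if r == 0 then A else r) -> adapted_at t.
  have s0 : 0 < if r == 0 then A else r.
    by case: eqVneq => [rz|rnz]; [rewrite (le_lt_trans r0)|rewrite lt0r rnz].
  apply: (all (Num.truncn (b / (if r == 0 then A else r))).+1) => //.
  by rewrite -ler_pdivrMr // ltW // truncnS_gt.
elim: n t => [|n IH] t t0 tn.
  move=> a' b' a'0 b't; rewrite (_ : [set _ | _] = setT).
    by apply: salg_setT; exact: (filt_sigma_algebra hF t0).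
  apply/seteqP; split => // w _ /=.
  rewrite set_itv_ge ?measure0 // bnd_simp -leNgt.
  by rewrite (le_trans b't) // (le_trans tn) // mul0r.
have [tn'|nt] := leP t (n%:R * (if r == 0 then A else r)); first exact: IH.
have n0 : 0 <= n%:R * (if r == 0 then A else r).
  by rewrite mulr_ge0 //; case: ifP => // _; rewrite (le_trans r0) // ltW.
apply: (adapted_step n0 (ltW nt)); last exact: IH.
by rewrite (le_trans tn) // -natr1 mulrDl mul1r.
Qed.

End adapted.

(** * The Poisson process of the strip *)

Section poisson_tail.
Variable R : realType.

Lemma poisson_pmf_sum (m : R) : 0 < m ->
  (\sum_(k <oo) (poisson_pmf m k)%:E = 1)%E.
Proof.
move=> m0; have h := probability_setT (poisson_prob m 0%N).
have pos k : (0 <= (poisson_pmf m k)%:E)%E by rewrite lee_fin poisson_pmf_ge0.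
have e : poisson_prob m 0%N setT = (\esum_(i in [set: nat]) (poisson_pmf m i)%:E)%E.
  by rewrite /poisson_prob m0.
by rewrite (nneseries_esumT pos) -e; exact: h.
Qed.

Lemma poisson_prob_set1 (m : R) k : 0 < m ->
  poisson_prob m 0%N [set k] = (poisson_pmf m k)%:E.
Proof.
by move=> m0; rewrite /poisson_prob m0 esum_set1 // lee_fin poisson_pmf_ge0.
Qed.

Lemma poisson_pmf_tilt (m s : R) k : 0 < m ->
  expR (s * k%:R) * poisson_pmf m k =
  expR (m * (expR s - 1)) * poisson_pmf (m * expR s) k.
Proof.
move=> m0; have m0' : 0 < m * expR s by rewrite mulr_gt0 ?expR_gt0.
rewrite /poisson_pmf m0 m0' [s * _]mulrC expRM_natl exprMn.
rewrite (_ : expR (- m) = expR (m * (expR s - 1)) * expR (- (m * expR s))).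
  by ring.
by rewrite -expRD; congr expR; ring.
Qed.

(** Exponential tilting turns the Poisson weights of mean [m] into those of mean [m * expR s], whose
    total mass 1 supplies the moment generating function. *)
Lemma poisson_chernoff (m s c : R) : 0 < m -> 0 <= s ->
  (\sum_(k <oo) (if (c < k%:R)%R then (poisson_pmf m k)%:E else 0) <=
   (expR (m * (expR s - 1) - s * c))%:E)%E.
Proof.
move=> m0 s0; have m0' : 0 < m * expR s by rewrite mulr_gt0 ?expR_gt0.
apply: (@le_trans _ _ (\sum_(k <oo) ((expR (m * (expR s - 1) - s * c))%:E *
    (poisson_pmf (m * expR s) k)%:E))%E).
  apply: lee_nneseries => [k _ _|k _].
    by case: ifP => // _; rewrite lee_fin poisson_pmf_ge0.
  case: ifPn => [ck|_]; last by rewrite mule_ge0 ?lee_fin ?poisson_pmf_ge0 ?expR_ge0.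
  rewrite -EFinM lee_fin [_ - s * c]addrC expRD -mulrA -poisson_pmf_tilt // mulrA.
  rewrite -expRD ler_peMl ?poisson_pmf_ge0 // -[X in X <= _]expR0 ler_expR.
  by have := ler_wpM2l s0 (ltW ck); lra.
rewrite nneseriesZl; last by move=> k _; rewrite lee_fin poisson_pmf_ge0.
by rewrite poisson_pmf_sum // mule1.
Qed.

(* [exp s - 1 <= s / (1 - s)] makes the Chernoff exponent negative for [s] small. *)
Lemma chernoff_exponent (lambda eps : R) : 0 < lambda -> 0 < eps ->
  exists2 s, 0 <= s & lambda * (expR s - 1) - s * (lambda + eps) < 0.
Proof.
move=> l0 e0; have le0 : 0 < lambda + eps by exact: addr_gt0.
pose s := eps / (2 * (lambda + eps)).
have s0 : 0 < s by rewrite divr_gt0 // mulr_gt0.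
have sE : 2 * (s * (lambda + eps)) = eps.
  by rewrite /s; field; rewrite gt_eqF.
have s1 : s < 1 by nra.
exists s; first exact: ltW.
have h : (1 - s) * expR s <= 1.
  have := expR_ge1Dx (- s).
  by rewrite -(ler_pM2r (expR_gt0 s)) -expRD addNr expR0.
rewrite subr_lt0 -(ltr_pM2l (_ : 0 < 1 - s)) ?subr_gt0 //.
apply: (@le_lt_trans _ _ (lambda * s)); first by nra.
by nra.
Qed.

End poisson_tail.

Section poisson_strip.
Context (R : realType) (d : measure_display) (T : measurableType d)
  (P : probability T R) (F : R -> set (set T))
  (Q : T -> {measure set (R * R)%type -> \bar R}) (lambda : R).
Hypotheses (hQ : filtered_poisson P F Q) (lambda0 : 0 < lambda).

Let hP := fp_poisson hQ.

Lemma strip_integer w (B : set R) : measurable B ->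
  strip (Q w) lambda B = +oo%E \/ exists k : nat, strip (Q w) lambda B = k%:R%:E.
Proof.
move=> mB; apply: (pp_integer (ppp_point_process hP)); exact: measurableX.
Qed.

Lemma measurable_strip (B : set R) : measurable B ->
  measurable_fun setT (fun w => strip (Q w) lambda B).
Proof.
by move=> mB; apply: (pp_measurable (ppp_point_process hP)); exact: measurableX.
Qed.

Lemma strip_level_measurable (B : set R) (x : \bar R) : measurable B ->
  measurable [set w | strip (Q w) lambda B = x].
Proof.
move=> mB; have := measurable_strip mB measurableT (@emeasurable_set1 R x).
by rewrite setTI.
Qed.

Lemma strip_law (a b : R) k : 0 <= a -> a < b ->
  P [set w | strip (Q w) lambda `]a, b]%classic = k%:R%:E] =
  (poisson_pmf (lambda * (b - a)) k)%:E.
Proof.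
move=> a0 ab; have m0 : 0 < lambda * (b - a) by rewrite mulr_gt0 ?subr_gt0.
have muE : (@lebesgue_measure R \x @lebesgue_measure R)%E
    (`]a, b]%classic `*` `]0, lambda]%classic) = (lambda * (b - a))%:E.
  have itvE (x y : R) : x < y -> lebesgue_measure (`]x, y]%classic : set R) = (y - x)%:E.
    by move=> xy; rewrite lebesgue_measure_itv /= lte_fin xy.
  rewrite product_measure1E //.
  by rewrite [LHS](congr2 mule (itvE _ _ ab) (itvE _ _ lambda0)) -EFinM subr0 mulrC.
rewrite (ppp_law hP) ?muE ?ltry //=.
- exact: poisson_prob_set1.
- exact: measurableX.
- move=> [x y] [/=]; rewrite !in_itv /= => /andP[ax _] /andP[y0 _].
  by split => //=; exact: le_lt_trans ax.
Qed.

Lemma strip_null_prob (a b : R) : 0 <= a -> a < b ->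
  P [set w | strip (Q w) lambda `]a, b]%classic = 0%E] =
  (expR (- (lambda * (b - a))))%:E.
Proof.
move=> a0 ab; have m0 : 0 < lambda * (b - a) by rewrite mulr_gt0 ?subr_gt0.
by rewrite (strip_law 0 a0 ab) /poisson_pmf m0 expr0 fact0 invr1 !mul1r.
Qed.

Lemma strip_infinite_null (a b : R) : 0 <= a -> a < b ->
  P [set w | strip (Q w) lambda `]a, b]%classic = +oo%E] = 0%E.
Proof.
move=> a0 ab; have m0 : 0 < lambda * (b - a) by rewrite mulr_gt0 ?subr_gt0.
pose X k := [set w | strip (Q w) lambda `]a, b]%classic = k%:R%:E].
have mX k : measurable (X k) by exact: strip_level_measurable.
have XE : [set w | strip (Q w) lambda `]a, b]%classic = +oo%E] = ~` \bigcup_k X k.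
  apply/seteqP; split => w /=.
    by move=> h [k _]; rewrite /X /= h.
  case: (strip_integer w (measurable_itv `]a, b])) => // -[k h] n.
  by exfalso; apply: n; exists k.
rewrite XE probability_setC; last exact: bigcupT_measurable.
rewrite measure_bigcup //; last first.
  apply/trivIsetP => i j _ _ ij; rewrite -subset0 => w [e1 e2].
  by move: e1; rewrite /X /= e2 => -[/eqP]; rewrite eqr_nat eq_sym (negbTE ij).
have -> : (\sum_(i <oo | i \in [set: nat]) P (X i) = \sum_(i <oo) P (X i))%E.
  by apply: congr_lim; apply/funext => n; apply: eq_bigl => k; rewrite mem_set.
rewrite (eq_eseriesr (fun k _ => strip_law k a0 ab)) poisson_pmf_sum //.
by rewrite subee.
Qed.

(** Local finiteness concerns compact subsets of the open quadrant and says nothing near its axes;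
    finiteness comes from the Poisson law, whose weights on the integers sum to 1. *)
Lemma strip_finite_ae :
  {ae P, forall w, forall n : nat, (strip (Q w) lambda `]0%R, n%:R%R]%classic < +oo)%E}.
Proof.
apply: ae_foralln => n; have [->|n0] := posnP n.
  by apply: aeW => w; rewrite set_itvoc0 measure0.
exists [set w | strip (Q w) lambda `]0%R, n%:R%R]%classic = +oo%E]; split.
- exact: strip_level_measurable.
- by apply: strip_infinite_null; rewrite // ltr0n.
- by move=> w /=; rewrite ltey => /negP; rewrite negbK => /eqP.
Qed.

(** Borel-Cantelli with the Chernoff bound, which decays geometrically along the grid. *)
Lemma strip_tail_ae (delta eps : R) : 0 < delta -> 0 < eps ->
  {ae P, forall w, \forall n \near \oo,
    (strip (Q w) lambda `]0%R, (n%:R * delta)%R]%classic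
       <= ((lambda + eps) * (n%:R * delta))%:E)%E}.
Proof.
move=> d0 e0; have [s s0 exps] := chernoff_exponent lambda0 e0.
pose X n := [set w | (((lambda + eps) * (n.+1%:R * delta))%:E <
    strip (Q w) lambda `]0%R, (n.+1%:R * delta)%R]%classic)%E].
have mX n : measurable (X n).
  have := emeasurable_fun_o_infty measurableT (measurable_strip
    (measurable_itv `]0, n.+1%:R * delta])) ((lambda + eps) * (n.+1%:R * delta))%:E.
  by rewrite setTI.
pose kappa := expR (delta * (lambda * (expR s - 1) - s * (lambda + eps))).
have PX n : (P (X n) <= (kappa ^+ n.+1)%:E)%E.
  have t0 : 0 < n.+1%:R * delta by rewrite mulr_gt0.
  have m0 : 0 < lambda * (n.+1%:R * delta) by rewrite mulr_gt0.
  pose B : set R := `]0, n.+1%:R * delta]%classic.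
  pose c := (lambda + eps) * (n.+1%:R * delta).
  pose Y k := if c < k%:R then [set w | strip (Q w) lambda B = k%:R%:E] else set0.
  have mY k : measurable (Y k).
    rewrite /Y; case: ifP => // _; apply: strip_level_measurable.
    exact: measurable_itv.
  (* Index 0 carries the infinite value, of probability zero, so that the union covers the whole
     tail event. *)
  pose Y' k := if k is k'.+1 then Y k' else [set w | strip (Q w) lambda B = +oo%E].
  have mY' k : measurable (Y' k).
    case: k => [|k]; last exact: mY.
    exact: (strip_level_measurable +oo%E (measurable_itv _)).
  have sub : X n `<=` \bigcup_k Y' k.
    move=> w; rewrite /X /= -/B -/c.
    case: (strip_integer w (measurable_itv `]0%R, n.+1%:R * delta])) => [h _|[k h]].
      by exists 0%N.
    by rewrite h lte_fin => ck; exists k.+1 => //=; rewrite /Y ck.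
  apply: le_trans (@measure_sigma_subadditive _ _ _ P (X n) Y' mY' (mX n) sub) _.
  have PY0 k : (0 <= P (Y' k))%E by exact: measure_ge0.
  rewrite nneseries_recl // -(nneseries_addn 1 PY0).
  have PY00 : P (Y' 0%N) = 0%E by exact: strip_infinite_null.
  rewrite /= in PY00 *; rewrite PY00 add0e.
  apply: (@le_trans _ _ (\sum_(k <oo) (if (c < k%:R)%R then
      (poisson_pmf (lambda * (n.+1%:R * delta)) k)%:E else 0))%E).
    apply: lee_nneseries => k _; first by move=> _; exact: measure_ge0.
    rewrite addn1 /= /Y; case: ifP => _; last by rewrite measure0.
    by rewrite strip_law // subr0.
  apply: le_trans (poisson_chernoff c m0 s0) _.
  rewrite lee_fin /kappa -expRM_natl ler_expR /c.
  by rewrite le_eqVlt; apply/orP; left; apply/eqP; ring.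
have k1 : kappa < 1 by rewrite /kappa expR_lt1 pmulr_rlt0.
have k0 : 0 < kappa by exact: expR_gt0.
have fin : (\sum_(n <oo) P (X n) < +oo)%E.
  apply: (@le_lt_trans _ _ (\sum_(n <oo) (kappa ^+ n.+1)%:E)%E).
    by apply: lee_nneseries => n _; [move=> _; exact: measure_ge0|exact: PX].
  apply: (@le_lt_trans _ _ (kappa * (1 - kappa)^-1)%:E); last exact: ltry.
  apply: lime_le; first by apply: is_cvg_nneseries => n _ _; rewrite lee_fin exprn_ge0 // ltW.
  apply: nearW => n; rewrite big_mkord sumEFin lee_fin.
  have := @geometric_le_lim R n kappa kappa (ltW k0) k0.
  rewrite ger0_norm ?(ltW k0) // => /(_ k1); rewrite /series /= big_mkord /geometric /=.
  by under eq_bigr do rewrite -exprS.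
have := lim_sup_set_cvg0 mX fin => null.
exists (lim_sup_set X); split => //.
  by apply: bigcap_measurable => // n _; apply: bigcup_measurable => k _; exact: mX.
move=> w nw n _ /=; apply: contrapT => nX; apply: nw.
exists n.+1 => // -[|k] //= nk; rewrite leNgt; apply/negP => h.
by apply: nX; exists k.
Qed.

End poisson_strip.

(** * Bounds at a given mesh *)

Section boolean_events.
Variables (T : Type) (S : set (set T)).
Hypothesis sS : sigma_algebra setT S.

Definition decided (b : T -> bool) := S [set w | b w].

Lemma decidedN b : decided b -> decided (fun w => ~~ b w).
Proof.
move=> Sb; rewrite /decided (_ : [set w | ~~ b w] = ~` [set w | b w]).
  exact: salg_setC.
by apply/seteqP; split => w /=; move/negP.
Qed.

Lemma decided_cst c : decided (fun=> c).
Proof.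
rewrite /decided; case: c.
  rewrite (_ : [set w | true] = setT); first exact: salg_setT.
  by apply/seteqP; split.
rewrite (_ : [set w | false] = set0); first exact: salg_set0.
by apply/seteqP; split.
Qed.

Lemma decided_and b c : decided b -> decided c -> decided (fun w => b w && c w).
Proof.
move=> Sb Sc; rewrite /decided (_ : [set w | _] = [set w | b w] `&` [set w | c w]).
  exact: salg_setI.
by apply/seteqP; split => w /=; [move/andP|move=> [-> ->]].
Qed.

Lemma decided_exists (I : finType) (b : T -> I -> bool) :
  (forall i, decided (b^~ i)) -> decided (fun w => [exists i, b w i]).
Proof.
move=> Sb; rewrite /decided (_ : [set w | _] = \bigcup_i [set w | b w i]).
  exact: salg_bigcup.
by apply/seteqP; split => w /=; [move=> /existsP[i bi]; exists i|move=> [i _ bi]; apply/existsP; exists i].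
Qed.

Lemma decided_forall (I : finType) (b : T -> I -> bool) :
  (forall i, decided (b^~ i)) -> decided (fun w => [forall i, b w i]).
Proof.
move=> Sb; rewrite /decided (_ : [set w | _] = [set w | ~~ [exists i, ~~ b w i]]).
  by apply: decidedN; apply: decided_exists => i; exact: decidedN.
by apply/seteqP; split => w /=; rewrite negb_exists => /forallP h; apply/forallP => i;
  move: (h i); rewrite negbK.
Qed.

End boolean_events.

Definition total (R : realType) (mu : {measure set R -> \bar R}) (t : R) : R :=
  fine (mu `]0%R, t]%classic).

(** * The Hawkes process on a fixed grid *)

Section hawkes_grid.
Context (R : realType) (d : measure_display) (T : measurableType d)
  (P : probability T R) (F : R -> set (set T))
  (Q : T -> {measure set (R * R)%type -> \bar R})
  (N : T -> {measure set R -> \bar R}) (lambda r A : R).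
Hypotheses (hF : usual_conditions P F) (hQ : filtered_poisson P F Q)
  (lambda0 : 0 < lambda) (r0 : 0 <= r) (rA : r < A).
Hypothesis path_ae :
  {ae P, forall w, thinned r A (strip (Q w) lambda) (N w)}.

Variables (delta : R) (L M : nat).
Hypotheses (delta0 : 0 < delta) (rE : r = L%:R * delta)
  (AM : M%:R * delta <= A) (MA : A < M.+1%:R * delta) (LM : (L < M)%N).

Let q := expR (- (lambda * delta)).
Let xi w k := hit (strip (Q w) lambda) delta k.
Let eta w k := event (N w) delta k.

Let grid0 (k : nat) : 0 <= k%:R * delta.
Proof. exact: cell_ge0. Qed.

Let sF k := filt_sigma_algebra hF (grid0 k).

Let Fmono (j k : nat) X : (j <= k)%N -> F (j%:R * delta) X -> F (k%:R * delta) X.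
Proof. by move=> jk; apply: (filt_mono hF) => //; rewrite ler_pM2r // ler_nat. Qed.

Lemma eta_decided j k : (j < k)%N -> decided (F (k%:R * delta)) (fun w => eta w j).
Proof.
move=> jk; apply: (Fmono jk).
apply: (decidedN (sF j.+1) (b := fun w => N w (cell delta j) == 0%E)).
rewrite /decided (_ : [set w | _] = [set w | N w (cell delta j) = 0%E]).
  exact: (counts_adapted hF hQ r0 rA path_ae).
by apply/seteqP; split => w /= /eqP.
Qed.

Lemma window_event_in (a l k : nat) :
  events_in Q ([set u : R | (k + a)%:R * delta < u] `*` @positive R)
   [set w | strip (Q w) lambda `](k + a)%:R * delta, (k + a + l)%:R * delta]%classic != 0%E].
Proof.
rewrite (_ : [set w | _] = ~` [set w | strip (Q w) lambda
    `](k + a)%:R * delta, (k + a + l)%:R * delta]%classic = 0%E]); last first.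
  by apply/seteqP; split => w /= /eqP.
apply: (salg_setC (smallest_sigma_algebra _ _)).
apply: strip_event_in => -[x y] [/=]; rewrite !in_itv /= => /andP[xa _] /andP[y0 _].
by split.
Qed.

Lemma window_decided (i j k : nat) : (j <= k)%N ->
  decided (F (k%:R * delta)) (fun w => strip (Q w) lambda
     `]i%:R * delta, j%:R * delta]%classic != 0%E).
Proof.
move=> jk; apply: (Fmono jk).
apply: (decidedN (sF j) (b := fun w => strip (Q w) lambda
     `]i%:R * delta, j%:R * delta]%classic == 0%E)).
rewrite /decided (_ : [set w | _] = [set w | strip (Q w) lambda
     `]i%:R * delta, j%:R * delta]%classic = 0%E]).
  exact: (strip_adapted lambda hQ).
by apply/seteqP; split => w /= /eqP.
Qed.

Lemma xi_decided j k : (j < k)%N -> decided (F (k%:R * delta)) (fun w => xi w j).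
Proof. exact: window_decided. Qed.

Lemma window_prob (i l : nat) : (0 < l)%N ->
  P [set w | strip (Q w) lambda `]i%:R * delta, (i + l)%:R * delta]%classic != 0%E] =
  (1 - q ^+ l)%:E.
Proof.
move=> l0; have lt : i%:R * delta < (i + l)%:R * delta.
  by rewrite ltr_pM2r // ltr_nat -[ltnLHS]addn0 ltn_add2l.
rewrite (_ : [set w | _] = ~` [set w | strip (Q w) lambda
    `]i%:R * delta, (i + l)%:R * delta]%classic = 0%E]); last first.
  by apply/seteqP; split => w /= /eqP.
rewrite probability_setC; last first.
  by apply: (strip_level_measurable lambda hQ); exact: measurable_itv.
rewrite (strip_null_prob hQ lambda0 (grid0 i) lt) -EFinB; congr (1 - _)%:E.
by rewrite /q -expRM_natl; congr expR; rewrite natrD; ring.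
Qed.

(** The range of dependence is [a + l]: once [j + (a + l) <= k], the events of index [j] are known
    before the window of index [k] opens. *)
Lemma grid_lln (H : T -> nat -> bool) (a l : nat) : (0 < l)%N ->
  (forall k, decided (F ((k + a)%:R * delta)) (H^~ k)) ->
  {ae P, forall w, averages_to (H w) (fun k => strip (Q w) lambda
      `](k + a)%:R * delta, (k + a + l)%:R * delta]%classic != 0%E) (1 - q ^+ l)}.
Proof.
move=> l0 dH.
pose Z k := [set w | strip (Q w) lambda
  `](k + a)%:R * delta, (k + a + l)%:R * delta]%classic != 0%E].
pose HH k := [set w | H w k].
have FH k : F ((k + a)%:R * delta) (HH k) by exact: dH.
have FZ k : F ((k + a + l)%:R * delta) (Z k) by exact: window_decided.
have mF k X : F (k%:R * delta) X -> measurable X by exact: (filt_measurable hF (grid0 k)).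
have q01 : 0 <= 1 - q ^+ l <= 1.
  have q0 : 0 <= q by exact: expR_ge0.
  have q1 : q <= 1 by rewrite /q expR_le1 oppr_le0 mulr_ge0 // ltW.
  by rewrite subr_ge0 exprn_ile1 //= gerBl exprn_ge0.
have indep X k : F ((k + a)%:R * delta) X -> P (X `&` Z k) = (P X * (1 - q ^+ l)%:E)%E.
  move=> FX; rewrite (fp_independent hQ (grid0 _) FX (@window_event_in a l k)).
  by congr (_ * _)%E; exact: window_prob.
have I1 j k : (j + (a + l) <= k)%N ->
    P (HH j `&` Z j `&` HH k `&` Z k) = (P (HH j `&` Z j `&` HH k) * (1 - q ^+ l)%:E)%E.
  move=> jk; apply: indep; apply: (salg_setI (sF _)) => //.
  apply: (salg_setI (sF _)); first by apply: (Fmono _ (FH j)); lia.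
  by apply: (Fmono _ (FZ j)); lia.
have I2 j k : (j + (a + l) <= k)%N ->
    P (HH j `&` HH k `&` Z k) = (P (HH j `&` HH k) * (1 - q ^+ l)%:E)%E.
  move=> jk; apply: indep; apply: (salg_setI (sF _)) => //.
  by apply: (Fmono _ (FH j)); lia.
have := events_lln (fun k => mF _ _ (FH k)) (fun k => mF _ _ (FZ k)) q01 I1 I2.
apply: filterS => w; apply: sublinear_ext => n; apply: eq_bigr => k _.
rewrite !indicE; congr (_%:R * (_%:R - _)); congr (nat_of_bool _).
  by apply/idP/idP; rewrite inE.
by apply/idP/idP; rewrite inE.
Qed.

Lemma occupied_window w a l : (0 < l)%N ->
  thinned r A (strip (Q w) lambda) (N w) ->
  (strip (Q w) lambda `]a%:R * delta, (a + l)%:R * delta]%classic != 0%E) =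
  occupied (xi w) a l.
Proof.
move=> l0 th; apply/idP/occupiedP => [|[j /andP[aj jal]]].
  move=> /(pi_atom th (grid0 a))[u /andP[au ua] pu].
  have u0 : 0 < u by exact: le_lt_trans au.
  have [j cj] := cell_exists delta0 u0; exists j.
    move: cj; rewrite /cell /= in_itv /= => /andP[ju uj].
    by have := lt_le_trans ju ua; have := lt_le_trans au uj; rewrite !ltr_grid //; clear; lia.
  rewrite /xi /hit; apply: contra_neq pu => p0; apply: null_subset p0.
  - exact: measurable_set1.
  - exact: measurable_itv.
  - by move=> _ ->.
rewrite /xi /hit; apply: contra_neq => p0; apply: null_subset p0.
- exact: measurable_itv.
- exact: measurable_itv.
move=> x; rewrite /cell /= !in_itv /= => /andP[jx xj].
by rewrite (le_lt_trans _ jx) ?(le_trans xj) // ler_pM2r // ler_nat.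
Qed.

Lemma waiting_decided j k : (j <= k)%N ->
  decided (F (k%:R * delta)) (fun w => waiting L M (eta w) j).
Proof.
move=> jk; apply: (decided_forall (sF k)) => i.
have := decidedN (sF k) (eta_decided (leq_trans (ltn_ord i) jk)) => de.
have [c|c] := boolP (j <= i + L + M + 1)%N.
  by under eq_fun do rewrite implyTb.
by under eq_fun do rewrite implyFb; exact: decided_cst.
Qed.

Lemma just_released_decided j k : (j <= k)%N ->
  decided (F (k%:R * delta)) (fun w => just_released L M (eta w) j).
Proof.
move=> jk; apply: (decided_exists (sF k)) => i; apply: decided_and => //.
  exact: decided_cst.
by apply: eta_decided; exact: leq_trans jk.
Qed.

Lemma after_bad_decided k :
  decided (F (k%:R * delta)) (fun w => after_bad L M (xi w) (eta w) k).
Proof.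
apply: (decided_exists (sF k)) => i; apply: decided_and => //.
  exact: decided_cst.
apply: decided_and => //; first by apply: just_released_decided; exact: ltnW.
exact: xi_decided.
Qed.

Lemma first_decided k :
  decided (F (k.+1%:R * delta)) (fun w => first L M (eta w) k).
Proof.
apply: decided_and => //; first by apply: waiting_decided.
exact: eta_decided.
Qed.

Lemma xi_averages (H : T -> nat -> bool) :
  (forall k, decided (F (k%:R * delta)) (H^~ k)) ->
  {ae P, forall w, averages_to (H w) (xi w) (1 - q)}.
Proof.
move=> dH; have : {ae P, forall w, averages_to (H w) (fun k => strip (Q w) lambda
      `](k + 0)%:R * delta, (k + 0 + 1)%:R * delta]%classic != 0%E) (1 - q ^+ 1)}.
  by apply: grid_lln => // k; rewrite addn0.
apply: filterS => w; rewrite expr1; apply: averages_ext => k.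
by rewrite addn0 addn1.
Qed.

Lemma occupied_averages : {ae P, forall w, forall a l, (0 < a)%N ->
  averages_to (first L M (eta w)) (fun k => occupied (xi w) (k + a) l) (1 - q ^+ l)}.
Proof.
suff main a l : {ae P, forall w, averages_to (first L M (eta w))
    (fun k => occupied (xi w) (k + a.+1) l) (1 - q ^+ l)}.
  have := ae_foralln (fun a => ae_foralln (main a)).
  by apply: filterS => w h [|a] l // _; exact: h.
case: l => [|l].
  apply: aeW => w; rewrite expr0 subrr.
  apply: (averages_ext _ (averages_false _)) => k.
  by apply/esym/negbTE/occupiedP => -[j]; lia.
have dH k : decided (F ((k + a.+1)%:R * delta)) (fun w => first L M (eta w) k).
  by apply: (Fmono _ (first_decided k)); lia.
have := grid_lln (ltn0Sn l) dH; apply: filterS2 path_ae => w th.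
by apply: averages_ext => k; exact: occupied_window.
Qed.

Lemma grid_density : {ae P, forall w, exists2 v, sublinear v & forall n,
  (1 + L%:R * (1 - q) - (1 - q)) *
     ((1 - 2 * (2 * L + M + 1)%:R * (1 - q) ^+ 2) / (cycle_cells L M q + 1)) * n%:R - v n
    <= \sum_(k < n) (eta w k)%:R
    <= (1 + L%:R * (1 - q)) * ((cycle_cells L M q)^-1 + 2 * (1 - q) ^+ 2) * n%:R + v n
  /\ (1 - q) * n%:R - v n <= \sum_(k < n) (xi w k)%:R}.
Proof.
have A1 := @xi_averages (fun=> xpredT) (fun k => decided_cst (sF k) true).
have A2 := xi_averages (fun k => waiting_decided (leqnn k)).
have A3 := xi_averages (fun k => just_released_decided (leqnn k)).
have A4 := xi_averages after_bad_decided.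
have q1 : q < 1 by rewrite /q expR_lt1 oppr_lt0 mulr_gt0.
have A12 : {ae P, forall w, averages_to xpredT (xi w) (1 - q) /\
    averages_to (waiting L M (eta w)) (xi w) (1 - q)}.
  by apply: filterS2 A1 A2 => w; split.
have A34 : {ae P, forall w, averages_to (just_released L M (eta w)) (xi w) (1 - q) /\
    averages_to (after_bad L M (xi w) (eta w)) (xi w) (1 - q)}.
  by apply: filterS2 A3 A4 => w; split.
have A0 : {ae P, forall w, thinned r A (strip (Q w) lambda) (N w) /\
    forall a l, (0 < a)%N -> averages_to (first L M (eta w))
      (fun k => occupied (xi w) (k + a) l) (1 - q ^+ l)}.
  by apply: filterS2 path_ae occupied_averages => w; split.
apply: filterS3 A0 A12 A34 => w [th oa] [a1 a2] [a3 a4].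
have xa (H : nat -> bool) : H = xpredT \/ H = waiting L M (eta w) \/
    H = just_released L M (eta w) \/ H = after_bad L M (xi w) (eta w) ->
    averages_to H (xi w) (1 - q).
  by move=> [->|[->|[->|->]]].
have [v sv Ev] := discrete_density LM (event_hit th delta0)
  (event_block th delta0 rE AM) (event_accept th delta0 rE MA)
  (expR_gt0 _) q1 xa oa.
pose u n := \sum_(k < n) (true%:R * ((xi w k)%:R - (1 - q))).
exists (fun n => `|v n| + `|u n|).
  by apply: sublinearD; exact: sublinear_norm.
move=> n; have /andP[e1 e2] := Ev n.
have := ler_norm (v n); have := normr_ge0 (v n).
have := ler_norm (- u n); have := normr_ge0 (u n); rewrite normrN.
have -> : u n = \sum_(k < n) (xi w k)%:R - (1 - q) * n%:R.
  rewrite /u; under eq_bigr do rewrite mul1r.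
  by rewrite big_split /= sumr_const card_ord mulNrn mulr_natr.
move=> h1 h2 h3 h4; split; last by lra.
apply/andP; split.
  by apply: le_trans e1; rewrite lerD2l lerN2 (le_trans (ler_norm _)) // lerDl.
by apply: le_trans e2 _; rewrite lerD2l (le_trans (ler_norm _)) // lerDl.
Qed.

Let lo : R := (1 + L%:R * (1 - q) - (1 - q)) *
  ((1 - 2 * (2 * L + M + 1)%:R * (1 - q) ^+ 2) / (cycle_cells L M q + 1)).
Let hi : R := (1 + L%:R * (1 - q)) * ((cycle_cells L M q)^-1 + 2 * (1 - q) ^+ 2).

Lemma total_nu_le w (s t : R) : thinned r A (strip (Q w) lambda) (N w) -> s <= t ->
  total (N w) s <= total (N w) t.
Proof.
move=> th st; have fin x : (N w `]0%R, x]%classic) \is a fin_num.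
  by rewrite ge0_fin_numE //; exact: nu_itv_fin th _ _ (lexx 0).
apply: fine_le => //; apply: le_measure; rewrite ?inE // => x /=.
by rewrite !in_itv /= => /andP[-> xs]; exact: le_trans st.
Qed.

(** Cell by cell: if N charges the cell then so does pi, both indicators are 1 and N is at most pi;
    otherwise the left excess is 0 and the right one nonnegative. *)
Lemma total_sandwich w n : thinned r A (strip (Q w) lambda) (N w) ->
  \sum_(k < n) (eta w k)%:R <= total (N w) (n%:R * delta) /\
  total (N w) (n%:R * delta) - \sum_(k < n) (eta w k)%:R <=
    total (strip (Q w) lambda) (n%:R * delta) - \sum_(k < n) (xi w k)%:R.
Proof.
move=> th.
have split_total (mu : {measure set R -> \bar R}) m :
    (forall (a b : R), 0 <= a -> (mu `]a, b]%classic < +oo)%E) ->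
    total mu (m.+1%:R * delta) = total mu (m%:R * delta) + fine (mu (cell delta m)).
  move=> fin; rewrite /total -fineD ?ge0_fin_numE ?fin //.
  congr fine; rewrite -measureU //.
  - congr (mu _); apply/seteqP; split => x; rewrite /cell /= !in_itv /=.
      by move=> /andP[x0 xm]; have [h|h] := leP x (m%:R * delta); [left; rewrite x0|right].
    move=> [] /andP[h1 h2]; rewrite ?h2 ?(le_lt_trans (grid0 m) h1) ?h1 //=.
    by rewrite (le_trans h2) // ler_grid.
  - exact: measurable_itv.
  - rewrite -subset0 => x []; rewrite /cell /= !in_itv /= => /andP[_ h] /andP[h' _].
    by move: (lt_le_trans h' h); rewrite ltxx.
elim: n => [|n [IH1 IH2]].
  by rewrite !big_ord0 /total mul0r set_itvoc0 !measure0 /=; split; lra.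
rewrite !big_ord_recr /= !split_total; last 2 first.
- exact: pi_itv_fin th.
- exact: nu_itv_fin th.
have mc : measurable (cell delta n) by exact: measurable_itv.
have cell_le : fine (N w (cell delta n)) <= fine (strip (Q w) lambda (cell delta n)).
  apply: fine_le; rewrite ?ge0_fin_numE ?(pi_itv_fin th _ (grid0 n)) ?(nu_itv_fin th _ (grid0 n)) //.
  by apply: (thinned_le th) => //; exact: cell_positive.
have ge1 (mu : {measure set R -> \bar R}) : (mu (cell delta n) < +oo)%E ->
    (forall B : set R, measurable B -> mu B = +oo%E \/ exists k : nat, mu B = k%:R%:E) ->
    mu (cell delta n) != 0%E -> 1 <= fine (mu (cell delta n)).
  move=> fin int n0; rewrite -lee_fin fineK ?ge0_fin_numE //.
  exact: integer_ge1.
have := ge1 _ (nu_itv_fin th _ (grid0 n)) (thinned_int th).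
have := ge1 _ (pi_itv_fin th _ (grid0 n)) (thinned_int_pi th).
have := @event_hit _ _ _ _ _ th delta delta0 n.
rewrite /eta /xi /event /hit.
have [h1|h1] := eqVneq (N w (cell delta n)) 0%E.
  rewrite h1 /= => _; have [h2|h2] := eqVneq (strip (Q w) lambda (cell delta n)) 0%E.
    by rewrite h2 /= => _ _; split; lra.
  by move=> /(_ isT) h3 _ /=; split; lra.
move=> /(_ isT) -> _ /(_ isT) h3 /=; split; first lra.
by move: cell_le h3; lra.
Qed.

Lemma density_bounds (eps : R) : 0 < eps ->
  {ae P, forall w, \forall t \near +oo%R,
    lo / delta - eps <= total (N w) t / t
      <= hi / delta + lambda - (1 - q) / delta + eps}.
Proof.
move=> eps0; have e80 : 0 < eps / 8 by rewrite divr_gt0.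
have tail := strip_tail_ae hQ lambda0 delta0 e80.
apply: filterS3 path_ae grid_density tail => w th [v sv Ev] [n1 _ Hn1].
(* Error budget per cell: [2 * e] is spent below and [4 * e] above, while [8 * e] per cell amounts
   to [eps] per unit of time. *)
pose e := eps * delta / 8; have e0 : 0 < e by rewrite divr_gt0 // mulr_gt0.
have [n2 _ Hn2] : \forall n \near \oo, `|v n / n%:R| <= e.
  by move/cvgrPdist_le: sv => /(_ _ e0); apply: filterS => n; rewrite sub0r normrN.
have vle n : (n2 < n)%N -> v n <= e * n%:R.
  move=> n2n; have n0 : 0 < n%:R :> R by rewrite ltr0n; move: n2n; clear; lia.
  rewrite -ler_pdivrMr //; apply: le_trans (ler_norm _) _.
  by apply: Hn2 => /=; exact: ltnW.
pose U := hi + lambda * delta - (1 - q) + 3 * e.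
have bnd n : (n1 + n2 < n)%N -> (lo - e) * n%:R <= total (N w) (n%:R * delta) <= U * n%:R.
  move=> nn; have [/andP[lo_le hi_ge] xi_ge] := Ev n.
  have [s1 s2] := total_sandwich n th.
  have vn : v n <= e * n%:R by apply: vle; move: nn; clear; lia.
  have tl : total (strip (Q w) lambda) (n%:R * delta) <= (lambda + eps / 8) * (n%:R * delta).
    rewrite -lee_fin fineK; first by apply: Hn1 => /=; move: nn; clear; lia.
    by rewrite ge0_fin_numE //; exact: pi_itv_fin th _ _ (lexx 0).
  have eE : eps / 8 * (n%:R * delta) = e * n%:R by rewrite /e; field.
  rewrite /U; move: lo_le hi_ge xi_ge s1 s2 vn tl eE; rewrite -/lo -/hi.
  move: (\sum_(k < n) (eta w k)%:R) (\sum_(k < n) (xi w k)%:R) => Y X.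
  by move=> *; apply/andP; split; lra.
pose B := `|U| + `|lo - e|.
(* The first term makes the grid index of [t] exceed [n1 + n2]; the second lets [e * (t / delta)]
   absorb [B], the cost of replacing [t / delta] by a neighbouring integer. *)
exists ((n1 + n2).+2%:R * delta + B * delta / e); split; first exact: num_real.
move=> t tB; have B0 : 0 <= B by rewrite addr_ge0.
have Bde : 0 <= B * delta / e
  by apply: divr_ge0; [apply: mulr_ge0 => //; exact: ltW|exact: ltW].
have t1 : (n1 + n2).+2%:R * delta < t by rewrite (le_lt_trans _ tB) // lerDl.
have t0 : 0 < t by apply: le_lt_trans t1; exact: grid0.
have Bt : B <= e * (t / delta).
  have h : B * delta / e <= t by apply: le_trans (ltW tB); rewrite lerDr grid0.
  rewrite ler_pdivrMr // in h.
  by rewrite mulrA ler_pdivlMr // (mulrC e).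
pose n := Num.truncn (t / delta).
have td0 : 0 <= t / delta by rewrite divr_ge0 // ltW.
have /andP[nt tn] := truncn_itv td0; rewrite -/n in nt tn.
have nn : (n1 + n2 < n)%N.
  have : (n1 + n2).+2%:R < n.+1%:R :> R.
    by rewrite (lt_trans _ tn) // ltr_pdivlMr.
  by rewrite ltr_nat; clear; lia.
have ndt : n%:R * delta <= t by rewrite -ler_pdivlMr.
have tnd : t <= n.+1%:R * delta by rewrite -ler_pdivrMr // ltW.
have /andP[l1 _] := bnd n nn.
have /andP[_ u1] := bnd n.+1 (ltnW nn).
have l2 := total_nu_le th ndt; have u2 := total_nu_le th tnd.
set x := t / delta in Bt td0 nt tn.
have tE : t = x * delta by rewrite /x mulfVK // gt_eqF.
have tn1 : x < n%:R + 1 by rewrite natr1.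
have theta : `|x - n%:R| <= 1 by rewrite ler_norml; apply/andP; split; lra.
have theta' : `|n.+1%:R - x| <= 1.
  by rewrite -[n.+1%:R]natr1 ler_norml; apply/andP; split; lra.
have lb : (lo - 2 * e) * x <= total (N w) t.
  have : `|(lo - e) * (x - n%:R)| <= B.
    rewrite normrM; apply: le_trans (ler_wpM2l (normr_ge0 _) theta) _.
    by rewrite mulr1 /B lerDr.
  move/(le_trans (ler_norm _)); move: l1 l2 Bt.
  by move: (total _ _) (total _ _) => ? ? *; lra.
have ub : total (N w) t <= (U + e) * x.
  have : `|U * (n.+1%:R - x)| <= B.
    rewrite normrM; apply: le_trans (ler_wpM2l (normr_ge0 _) theta') _.
    by rewrite mulr1 /B lerDl.
  move/(le_trans (ler_norm _)); move: u1 u2 Bt.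
  by move: (total _ _) (total _ _) => ? ? *; lra.
have xt : x = t / delta by [].
apply/andP; split.
  rewrite ler_pdivlMr //; apply: le_trans lb.
  rewrite (_ : (lo / delta - eps) * t = (lo - 8 * e) * x); last first.
    by rewrite tE /e; field; rewrite gt_eqF.
  by apply: ler_wpM2r => //; lra.
rewrite ler_pdivrMr //; apply: le_trans ub _.
rewrite (_ : (_ + eps) * t = (hi + lambda * delta - (1 - q) + 8 * e) * x); last first.
  by rewrite tE /e; field; rewrite gt_eqF.
by apply: ler_wpM2r => //; rewrite /U; lra.
Qed.

End hawkes_grid.

(** * Vanishing mesh *)

Section mesh_limit.
Variables (R : realType) (lambda r A : R).
Hypotheses (lambda0 : 0 < lambda) (r0 : 0 <= r) (rA : r < A).

(** Subdividing [r] makes the lag an exact number of cells, so that rounding affects [A] only; for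
    [r = 0] any vanishing mesh does. *)
Definition mesh (i : nat) : R := (if r == 0 then 1 else r) / i.+1%:R.
Definition lag_cells (i : nat) : nat := if r == 0 then 0%N else i.+1.
Definition inhibition_cells (i : nat) : nat := Num.truncn (A / mesh i).
Definition empty_prob (i : nat) : R := expR (- (lambda * mesh i)).

Let unit0 : 0 < (if r == 0 then 1 else r).
Proof. by case: eqVneq => // rn; rewrite lt0r rn. Qed.

Let A0 : 0 < A. Proof. exact: le_lt_trans rA. Qed.

Lemma mesh_gt0 i : 0 < mesh i.
Proof. by rewrite divr_gt0. Qed.

Lemma lag_cellsE i : r = (lag_cells i)%:R * mesh i.
Proof.
rewrite /lag_cells /mesh; case: eqVneq => [->|_]; first by rewrite mul0r.
by rewrite mulrC divfK.
Qed.

Lemma inhibition_cells_itv i :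
  (inhibition_cells i)%:R * mesh i <= A < (inhibition_cells i).+1%:R * mesh i.
Proof.
have m0 := mesh_gt0 i.
have := truncn_itv (ltW (divr_gt0 A0 m0)); rewrite -/(inhibition_cells i).
by rewrite ler_pdivlMr // ltr_pdivrMr.
Qed.

Lemma mesh_cvg : mesh @ \oo --> 0.
Proof.
rewrite -(mulr0 (if r == 0 then 1 else r)); apply: cvgMr.
exact: cvg_harmonic.
Qed.

Lemma lag_lt_inhibition : \forall i \near \oo, (lag_cells i < inhibition_cells i)%N.
Proof.
have Ar : 0 < A - r by rewrite subr_gt0.
have /cvgrPdist_lt/(_ _ Ar) := mesh_cvg; apply: filterS => i.
rewrite sub0r normrN ger0_norm ?(ltW (mesh_gt0 i)) // => mi.
have /andP[_ up] := inhibition_cells_itv i.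
rewrite -ltnS -(ltr_nat R) -(ltr_pM2r (mesh_gt0 i)); apply: le_lt_trans up.
by rewrite -natr1 mulrDl mul1r -lag_cellsE; lra.
Qed.

Lemma inhibition_cvg : (inhibition_cells i)%:R * mesh i @[i --> \oo] --> A.
Proof.
apply: (@squeeze_cvgr _ _ _ _ (fun i => A - mesh i) (fun=> A)).
- apply: nearW => i; have /andP[lo up] := inhibition_cells_itv i.
  by rewrite lo andbT; move: up; rewrite -natr1 mulrDl mul1r; lra.
- rewrite -[X in _ --> X]subr0; apply: cvgB; first exact: cvg_cst.
  exact: mesh_cvg.
- exact: cvg_cst.
Qed.

Definition hit_prob (i : nat) : R := 1 - empty_prob i.
Local Notation p := hit_prob.

Lemma empty_prob_lt1 i : empty_prob i < 1.
Proof. by rewrite /empty_prob expR_lt1 oppr_lt0 mulr_gt0 // mesh_gt0. Qed.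

Lemma hit_prob_gt0 i : 0 < p i.
Proof. by rewrite subr_gt0 empty_prob_lt1. Qed.

(** Squeeze by [1 + x <= expR x] at plus and minus [lambda * mesh i]. *)
Lemma hit_rate_cvg : p i / mesh i @[i --> \oo] --> lambda.
Proof.
apply: (@squeeze_cvgr _ _ _ _ (fun i => lambda - lambda ^+ 2 * mesh i) (fun=> lambda)).
- apply: nearW => i; have m0 := mesh_gt0 i; set m := mesh i in m0 *.
  have lm : 0 < lambda * m by exact: mulr_gt0.
  have e1 := expR_ge1Dx (- (lambda * m)).
  have e2 : (1 + lambda * m) * empty_prob i <= 1.
    have := expR_ge1Dx (lambda * m).
    rewrite -(ler_pM2r (expR_gt0 (- (lambda * m)))) -expRD subrr expR0.
    by rewrite /empty_prob.
  rewrite ler_pdivlMr // ler_pdivrMr // /hit_prob; move: e1 e2; rewrite -/(empty_prob i).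
  set q := empty_prob i => e1 e2; apply/andP; split; last by lra.
  rewrite (_ : (lambda - lambda ^+ 2 * m) * m = lambda * m - (lambda * m) ^+ 2); last by ring.
  by nra.
- rewrite -[X in _ --> X]subr0 -(mulr0 (lambda ^+ 2)); apply: cvgB; first exact: cvg_cst.
  by apply: cvgMr; exact: mesh_cvg.
- exact: cvg_cst.
Qed.

Lemma hit_prob_cvg : p @ \oo --> 0.
Proof.
rewrite -(mulr0 lambda) (_ : p = fun i => p i / mesh i * mesh i).
  by apply: cvgM; [exact: hit_rate_cvg|exact: mesh_cvg].
by apply/funext => i; rewrite divfK // gt_eqF // mesh_gt0.
Qed.

Lemma busy_meanE (L : nat) (q : R) :
  (1 - q) * busy_mean L q = (1 - q) * L%:R - q * (1 - q ^+ L).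
Proof.
elim: L => [|L IH]; first by rewrite /busy_mean big_ord0 expr0; ring.
have -> : busy_mean L.+1 q = (1 - q) + (busy_mean L q + \sum_(j < L) (1 - q) * q ^+ (L - j)).
  rewrite /busy_mean big_ord_recr /= subSnn expr1 addrC; congr (_ + _).
  rewrite -big_split; apply: eq_bigr => j _ /=.
  by rewrite subSn ?exprS; [ring|exact: ltnW].
have -> : \sum_(j < L) (1 - q) * q ^+ (L - j) = (1 - q) * (L%:R - busy_mean L q).
  rewrite -mulr_sumr /busy_mean; congr (_ * _).
  rewrite [in RHS](big_split) /= sumr_const card_ord.
  by rewrite sumrN opprD opprK addrA subrr add0r.
rewrite -[L.+1%:R]natr1 exprS.
rewrite (_ : (1 - q) * _ = (1 - q) ^+ 2 * (1 + L%:R) + q * ((1 - q) * busy_mean L q)); last by ring.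
by rewrite IH; ring.
Qed.

(** As the lag is a whole number of cells, the geometric sum ends exactly at
    [expR (- (lambda * r))]. In the limit this is the mean time between the first and last kept
    points of a cycle. *)
Lemma busy_mesh i : busy_mean (lag_cells i) (empty_prob i) * mesh i =
  r - empty_prob i * (1 - expR (- (lambda * r))) / (p i / mesh i).
Proof.
have m0 := mesh_gt0 i; have p0 := hit_prob_gt0 i.
have qL : empty_prob i ^+ lag_cells i = expR (- (lambda * r)).
  by rewrite /empty_prob -expRM_natl; congr expR; rewrite [in RHS](lag_cellsE i); ring.
have bE : busy_mean (lag_cells i) (empty_prob i) = (lag_cells i)%:R
    - empty_prob i * (1 - expR (- (lambda * r))) / p i.
  apply: (mulfI (lt0r_neq0 p0)); rewrite busy_meanE qL -/(p i).
  by field; rewrite gt_eqF.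
by rewrite bE mulrBl -lag_cellsE; field; rewrite !gt_eqF.
Qed.

Let rate : R := lambda * (1 + lambda * r)
       / (lambda * A + 2 * lambda * r + expR (- (lambda * r))).

(** The limit is the mean duration of a cycle, [A + 2 r + expR (- lambda r) / lambda], written as
    mean number of points over [rate]. *)
Lemma cycle_mesh_cvg :
  cycle_cells (lag_cells i) (inhibition_cells i) (empty_prob i) * mesh i
  @[i --> \oo] --> (1 + lambda * r) / rate.
Proof.
have E i : cycle_cells (lag_cells i) (inhibition_cells i) (empty_prob i) * mesh i =
  (p i / mesh i)^-1 + (r + (inhibition_cells i)%:R * mesh i) +
  (r - (1 - p i) * (1 - expR (- (lambda * r))) * (p i / mesh i)^-1).
  have qE : empty_prob i = 1 - p i by rewrite /hit_prob; ring.
  have -> : cycle_cells (lag_cells i) (inhibition_cells i) (empty_prob i) * mesh i =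
      (p i)^-1 * mesh i + (lag_cells i + inhibition_cells i)%:R * mesh i
      + busy_mean (lag_cells i) (empty_prob i) * mesh i by rewrite /cycle_cells !mulrDl.
  by rewrite busy_mesh -qE natrD [(_ + _) * mesh i]mulrDl -lag_cellsE invf_div
    [(p i)^-1 * _]mulrC.
under eq_fun do rewrite E.
have e0 := expR_gt0 (- (lambda * r)).
have lr0 : 0 <= lambda * r by rewrite mulr_ge0 // ltW.
have lA0 : 0 < lambda * A by exact: mulr_gt0.
have -> : (1 + lambda * r) / rate =
    lambda^-1 + (r + A) + (r - (1 - 0) * (1 - expR (- (lambda * r))) * lambda^-1).
  rewrite /rate; set e := expR _ in e0 *; field.
  by rewrite !gt_eqF //; lra.
have inv : (p i / mesh i)^-1 @[i --> \oo] --> lambda^-1.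
  by apply: cvgV; [rewrite gt_eqF|exact: hit_rate_cvg].
apply: cvgD; first apply: cvgD => //.
  by apply: cvgD; [exact: cvg_cst|exact: inhibition_cvg].
apply: cvgB; first exact: cvg_cst.
apply: cvgM => //; apply: cvgM; last exact: cvg_cst.
by apply: cvgB; [exact: cvg_cst|exact: hit_prob_cvg].
Qed.

Let lr1 : 0 < 1 + lambda * r.
Proof. by rewrite ltr_wpDr // mulr_ge0 // ltW. Qed.

Let rate0 : 0 < rate.
Proof.
rewrite divr_gt0 ?mulr_gt0 // addr_gt0 ?expR_gt0 // ltr_wpDr ?mulr_gt0 //.
by rewrite -mulrA mulr_ge0 // mulr_ge0 // ltW.
Qed.

Lemma lag_hit i : (lag_cells i)%:R * p i = r * (p i / mesh i).
Proof.
have m0 := mesh_gt0 i; rewrite [in RHS](lag_cellsE i).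
by rewrite mulrACA mulfV ?gt_eqF // mulr1.
Qed.

Lemma lower_density_cvg :
  (1 + (lag_cells i)%:R * p i - p i) *
    ((1 - 2 * (2 * lag_cells i + inhibition_cells i + 1)%:R * p i ^+ 2) /
    (cycle_cells (lag_cells i) (inhibition_cells i) (empty_prob i) + 1)) / mesh i
  @[i --> \oo] --> rate.
Proof.
(* Regrouping into [p i / mesh i] and numbers of cells times [mesh i], which have finite limits;
   each correction keeps a spare vanishing factor. *)
have E i : (1 + (lag_cells i)%:R * p i - p i) *
    ((1 - 2 * (2 * lag_cells i + inhibition_cells i + 1)%:R * p i ^+ 2) /
    (cycle_cells (lag_cells i) (inhibition_cells i) (empty_prob i) + 1)) / mesh i =
  (1 + r * (p i / mesh i) - p i) *
  ((1 - 2 * (2 * r + (inhibition_cells i)%:R * mesh i + mesh i) * (p i / mesh i) * p i) *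
   (cycle_cells (lag_cells i) (inhibition_cells i) (empty_prob i) * mesh i + mesh i)^-1).
  have m0 := mesh_gt0 i.
  rewrite lag_hit; set C := cycle_cells _ _ _.
  have -> : (C * mesh i + mesh i)^-1 = (C + 1)^-1 / mesh i.
    by rewrite -invfM [(C + 1) * _]mulrDl mul1r.
  have -> : 2 * (2 * lag_cells i + inhibition_cells i + 1)%:R * p i ^+ 2 =
      2 * (2 * r + (inhibition_cells i)%:R * mesh i + mesh i) * (p i / mesh i) * p i.
    by rewrite natrD natrD natrM [in RHS](lag_cellsE i); field; rewrite gt_eqF.
  by ring.
under eq_fun do rewrite E.
have -> : rate = (1 + r * lambda - 0) *
    ((1 - 2 * (2 * r + A + 0) * lambda * 0) * ((1 + lambda * r) / rate + 0)^-1).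
  by field; rewrite !gt_eqF.
apply: cvgM; first apply: cvgB; last apply: cvgM.
- by apply: cvgD; [exact: cvg_cst|apply: cvgMr; exact: hit_rate_cvg].
- exact: hit_prob_cvg.
- apply: cvgB; first exact: cvg_cst.
  apply: cvgM; last exact: hit_prob_cvg.
  apply: cvgM; last exact: hit_rate_cvg.
  apply: cvgMr; apply: cvgD; last exact: mesh_cvg.
  by apply: cvgD; [exact: cvg_cst|exact: inhibition_cvg].
- apply: cvgV; first by rewrite addr0 gt_eqF // divr_gt0.
  by apply: cvgD; [exact: cycle_mesh_cvg|exact: mesh_cvg].
Qed.

(** The difference [lambda - p i / mesh i] is the density of points of pi sharing a cell with
    another one, counted beyond the first; it vanishes with the mesh. *)
Lemma upper_density_cvg :
  (1 + (lag_cells i)%:R * p i) *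
    ((cycle_cells (lag_cells i) (inhibition_cells i) (empty_prob i))^-1
      + 2 * p i ^+ 2) / mesh i + lambda - p i / mesh i
  @[i --> \oo] --> rate.
Proof.
have E i : (1 + (lag_cells i)%:R * p i) *
    ((cycle_cells (lag_cells i) (inhibition_cells i) (empty_prob i))^-1
      + 2 * p i ^+ 2) / mesh i + lambda - p i / mesh i =
  (1 + r * (p i / mesh i)) *
  ((cycle_cells (lag_cells i) (inhibition_cells i) (empty_prob i) * mesh i)^-1
     + 2 * (p i / mesh i) * p i) + (lambda - p i / mesh i).
  rewrite lag_hit; set C := cycle_cells _ _ _.
  by rewrite [(C * _)^-1]invfM; ring.
under eq_fun do rewrite E.
have -> : rate = (1 + r * lambda) * (((1 + lambda * r) / rate)^-1 + 2 * lambda * 0)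
    + (lambda - lambda).
  by field; rewrite !gt_eqF.
apply: cvgD; last by apply: cvgB; [exact: cvg_cst|exact: hit_rate_cvg].
apply: cvgM; first by apply: cvgD; [exact: cvg_cst|apply: cvgMr; exact: hit_rate_cvg].
apply: cvgD; last first.
  by apply: cvgM; [apply: cvgMr; exact: hit_rate_cvg|exact: hit_prob_cvg].
by apply: cvgV; [rewrite gt_eqF // divr_gt0|exact: cycle_mesh_cvg].
Qed.

End mesh_limit.

(** * Almost sure convergence of the Hawkes process *)

Lemma hawkes_thinned (R : realType) (d : measure_display)
    (T : measurableType d) (P : probability T R) (F : R -> set (set T))
    (Q : T -> {measure set (R * R)%type -> \bar R})
    (lambda r A : R) (N : T -> {measure set R -> \bar R})
    (hQ : filtered_poisson P F Q) (hlambda : 0 < lambda)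
    (hN : hawkes_process P Q lambda
            (fun x : R => - lambda * \1_(`[r, r + A]) x) N) :
  {ae P, forall w, thinned r A (strip (Q w) lambda) (N w)}.
Proof.
have eqN := hawkes_equation hN; have pp := hawkes_point_process hN.
apply: filterS2 eqN (strip_finite_ae hQ hlambda) => w eqw finw.
have intw (B : set R) : measurable B ->
    N w B = +oo%E \/ exists k : nat, N w B = k%:R%:E.
  by move=> mB; exact: (pp_integer pp w mB).
split.
- exact: (strip_integer lambda hQ w).
- exact: intw.
- exact: (pp_support pp w).
- by move=> B mB Bpos; exact: (thinning_le hlambda intw eqw mB Bpos).
- exact: finw.
- by move=> u u0; exact: (thinning_point hlambda intw eqw u0).
Qed.

Unset Implicit Arguments.

Theorem proposition3p1 (R : realType) (d : measure_display)
    (T : measurableType d) (P : probability T R) (F : R -> set (set T))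
    (Q : T -> {measure set (R * R)%type -> \bar R})
    (lambda r A : R) (N : T -> {measure set R -> \bar R})
    (hF : usual_conditions P F)
    (hQ : filtered_poisson P F Q)
    (hlambda : 0 < lambda) (hr : 0 <= r) (hA : r < A)
    (hN : hawkes_process P Q lambda
            (fun x : R => - lambda * \1_(`[r, r + A]) x) N) :
  {ae P, forall w : T,
    (N w `[0%R, t]%classic * (t^-1)%:E)%E @[t --> +oo%R] -->
    (lambda * (1 + lambda * r)
       / (lambda * A + 2 * lambda * r + expR (- (lambda * r))))%:E}.
Proof.
set c := (X in X%:E).
have th_ae := hawkes_thinned hQ hlambda hN.
have close (e : R) : 0 < e -> {ae P, forall w, \forall t \near +oo%R,
    `|fine (N w `]0%R, t]%classic) / t - c| <= e}.
  move=> e0; have e2 : 0 < e / 2 by rewrite divr_gt0.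
  have /cvgrPdist_le/(_ _ e2) near_lo := lower_density_cvg hlambda hr hA.
  have /cvgrPdist_le/(_ _ e2) near_hi := upper_density_cvg hlambda hr hA.
  have [i _ /(_ i (leqnn i))] := filterI (filterI near_lo near_hi)
    (lag_lt_inhibition hr hA).
  move=> [[lo_c hi_c] LM]; have /andP[AM MA] := inhibition_cells_itv hr hA i.
  have := density_bounds hF hQ hlambda hr hA th_ae (mesh_gt0 hr i)
    (lag_cellsE r i) AM MA LM e2.
  apply: filterS => w; apply: filterS => t /andP[lo_t hi_t].
  move: lo_c hi_c lo_t hi_t; rewrite -/c /hit_prob /empty_prob /total.
  rewrite !ler_norml => /andP[_ lo_c] /andP[hi_c _] lo_t hi_t.
  by apply/andP; split; lra.
(* Countably many tolerances, so that one almost sure event serves them all. *)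
have all_close : {ae P, forall w, forall n : nat, \forall t \near +oo%R,
    `|fine (N w `]0%R, t]%classic) / t - c| <= n.+1%:R^-1}.
  by apply: ae_foralln => n; exact: close.
apply: filterS2 th_ae all_close => w th cl.
have cvg_fine : fine (N w `]0%R, t]%classic) / t @[t --> +oo%R] --> c.
  apply/cvgrPdist_le => e e0.
  have [n] := ltr_add_invr e0; rewrite add0r => /ltW ne.
  have := cl n; apply: filterS => t; rewrite distrC => /le_trans; exact.
have : (fine (N w `]0%R, t]%classic) / t)%:E @[t --> +oo%R] --> c%:E.
  by apply: cvg_EFin cvg_fine; exact: nearW.
apply: cvg_trans; apply: near_eq_cvg; near=> t.
have t0 : 0 <= t by near: t; exact: nbhs_pinfty_ge.
rewrite EFinM fineK; last by rewrite ge0_fin_numE //; exact: (nu_itv_fin th).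
congr (_ * _)%E.
(* The closed interval adds only the point 0, which the support condition makes null. *)
rewrite -(measureU0 (mu := N w) (A := `]0%R, t]%classic) (B := [set 0])) //.
  by rewrite setUC setU1itv.
apply: null_subset (thinned_supp th) => //.
  by apply: measurableC; exact: measurable_positive.
by move=> _ ->; rewrite /positive /= ltxx.
Unshelve. all: by end_near.
Qed.
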